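(* Consider the controlled $N$-particle systems, their finite-horizon values and the deterministic limit system described in the context, and assume: (A1) given the context value $C$ and the action $a$ at time $t$, the particles move independently of each other, each according to the Markov kernel $K(a,C)$; (A2) the action set $\mathcal{A}$ is compact; (A3) the maps $(C,a)\mapsto K(a,C)$, $(C,M,a)\mapsto g(C,M,a)$ and $(M,C)\mapsto r_t(M,C)$ are continuous deterministic functions, uniformly continuous in $a$; (A4-bis) almost surely $(M^N_0,C^N_0)$ converges to a deterministic value $(m_0,c_0)$, there is $B<\infty$ such that almost surely $\|C^N_0\|_\infty\le B$, and there is a Gaussian vector $G_0$ (with $S+d$ components) of mean $0$ and covariance $\Gamma_0$ such that $\sqrt N\big((M^N_0,C^N_0)-(m_0,c_0)\big)$ converges in law to $G_0$; (A5) for all $t$ and all $i,j\in\mathcal{S}$, all functions $g$, $K_{ij}$ and $r_t$ are continuously differentiable. Let $a^*_0,\dots,a^*_{T-1}$ be a sequence of actions with $v_{a^*_0\dots a^*_{T-1}}(m_0,c_0)=v^*_T(m_0,c_0)$. Then: (i) there exist constants $\beta$ and $\gamma$ such that for all $x$, $$\limsup_{N\to\infty}\mathbb{P}\Big(\sqrt N\,\big|V^{*N}_T(M^N_0,C^N_0)-v^*_T(m_0,c_0)\big|\ge x\Big)\le \mathbb{P}\big(\beta\|G_0\|_\infty+\gamma\ge x\big);$$ (ii) there exist constants $\beta',\gamma'>0$ such that for all $x$, $$\limsup_{N\to\infty}\mathbb{P}\Big(\sqrt N\,\big|V^{*N}_T(M^N_0,C^N_0)-V^N_{a^*_0\dots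 a^*_{T-1}}(M^N_0,C^N_0)\big|\ge x\Big)\le \mathbb{P}\big(\beta'\|G_0\|_\infty+\gamma'\ge x\big).$$
   Context: Model. Fix $S,d,T\ge 1$, $\mathcal{S}=\{1,\dots,S\}$, $\mathcal{P}(\mathcal{S})$ the set of probability measures on $\mathcal{S}$ (a subset of $\mathbb{R}^S$), and $\mathcal{P}_N(\mathcal{S})$ the set of $p\in\mathcal{P}(\mathcal{S})$ with $Np(i)\in\mathbb{N}$ for all $i$. $\mathcal{A}$ is the set of possible actions (finite or infinite). For $a\in\mathcal{A}$, $C\in\mathbb{R}^d$, $K(a,C)=(K_{i,j}(a,C))_{i,j\in\mathcal{S}}$ is a transition probability kernel on $\mathcal{S}$; $g$ is a function of $(C,M,a)\in\mathbb{R}^d\times\mathcal{P}(\mathcal{S})\times\mathcal{A}$ with values in $\mathbb{R}^d$; and $r_t:\mathcal{P}(\mathcal{S})\times\mathbb{R}^d\to\mathbb{R}$ are reward functions. None of these depends on $N$. For each $N$ there are $N$ particles with states $X^N_n(t)\in\mathcal{S}$; $(M^N_t)_i=\frac1N\sum_{n=1}^N\mathbf 1_{X^N_n(t)=i}$, so $M^N_t\in\mathcal{P}_N(\mathcal{S})$. If action $a_t$ is used at time $t$, each particle in state $i$ moves to state $j$ with probability $K_{i,j}(a_t,C^N_t)$, and then the context (environment) becomes $C^N_{t+1}=g(C^N_t,M^N_{t+1},a_t)\in\mathbb{R}^d$. The initial states $(M_0^N,C_0^N)$ may be random; $\|G\|_\infty=\sup_i|G_i|$. Values. A policy $\Pi=(\Pi_0,\dots,\Pi_{T-1})$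 is a sequence of maps $\Pi_t:\mathcal{P}_N(\mathcal{S})\times\mathbb{R}^d\to\mathcal{A}$ (deterministic Markovian policies); under it the action at time $t$ is $\Pi_t(M^N_t,C^N_t)$. For an initial state $(M,C)$, $V^N_{\Pi}(M,C)=\mathbb{E}\big[\sum_{t=1}^{T-1}r_t(M^N_t,C^N_t)+r_T(M^N_T,C^N_T)\big]$, the expectation being for the system started at $(M,C)$ under $\Pi$; $V^N_{a_0\dots a_{T-1}}$ is the value when the fixed action $a_t$ is used at each time $t$; $V^{*N}_T(M,C)=\sup_\Pi V^N_\Pi(M,C)$. These functions evaluated at the random initial state $(M^N_0,C^N_0)$ are random variables. Deterministic limit. $\Phi_a(m,c)=(m',c')$ with $m'=mK(a,c)$ and $c'=g(c,m',a)$; $\Phi_{a_0\dots a_{t-1}}$ denotes applying $\Phi_{a_0}$, then $\Phi_{a_1}$, ..., then $\Phi_{a_{t-1}}$. Put $v_{a_0\dots a_{T-1}}(m_0,c_0)=\sum_{t=1}^{T}r_t(\Phi_{a_0\dots a_{t-1}}(m_0,c_0))$ and $v^*_T(m_0,c_0)=\sup_{a_0,\dots,a_{T-1}\in\mathcal{A}}v_{a_0\dots a_{T-1}}(m_0,c_0)$; since $\mathcal{A}$ is compact, the supremum is a maximum. *)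

(* Defs.v *)
From HB Require Import structures.
From mathcomp Require Import all_boot all_order all_algebra all_fingroup.
From mathcomp Require Import all_classical all_reals all_analysis.

Set Implicit Arguments.
Unset Strict Implicit.
Unset Printing Implicit Defensive.

Import Order.TTheory GRing.Theory Num.Theory.
Import numFieldNormedType.Exports.

Local Open Scope classical_set_scope.
Local Open Scope ring_scope.

(* States are numbered from 0: the state space is 'I_S. Measures on it are row
   vectors, so that m *m K is the image of m under the kernel K. *)
Section simplex.
Variables (R : realType) (S : nat).

Definition simplex : set 'rV[R]_S :=
  [set m | (forall i, 0 <= m ord0 i) /\ \sum_i m ord0 i = 1].

Definition simplexN (N : nat) : set 'rV[R]_S :=
  [set m | simplex m /\ forall i, exists k : nat, N%:R * m ord0 i = k%:R].

Definition transition_kernel (k : 'M[R]_S) : Prop :=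
  (forall i j, 0 <= k i j) /\ forall i, \sum_j k i j = 1.

End simplex.

Notation config N S := {ffun 'I_N -> 'I_S}.
Notation trajectory T N S := {ffun 'I_T.+1 -> config N S}.

Definition empirical (R : realType) (N S : nat) (x : config N S) : 'rV[R]_S :=
  \row_i (N%:R^-1 * \sum_(n < N) (x n == i)%:R).

Section particle_system.
Variables (R : realType) (S d : nat) (A : Type).
Variable g : 'rV[R]_d -> 'rV[R]_S -> A -> 'rV[R]_d.
Variable r : nat -> 'rV[R]_S -> 'rV[R]_d -> R.
Variables (T N : nat).
(* [Q a C x y] is the probability that the N particles jump jointly from the
   configuration x to the configuration y under action a and context C. *)
Variable Q : A -> 'rV[R]_d -> config N S -> config N S -> R.

(* Only the values at times t < T and at measures in simplexN N matter. *)
Definition policy : Type := nat -> 'rV[R]_S -> 'rV[R]_d -> A.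

Implicit Types (Pi : policy) (x : config N S) (M : 'rV[R]_S) (C : 'rV[R]_d)
  (w : trajectory T N S).

Definition measure_at w (t : nat) : 'rV[R]_S := empirical R (w (inord t)).

Fixpoint context_at Pi C w (t : nat) : 'rV[R]_d :=
  if t is s.+1 then
    let Cs := context_at Pi C w s in
    g Cs (measure_at w s.+1) (Pi s (measure_at w s) Cs)
  else C.

Definition action_at Pi C w (t : nat) : A :=
  Pi t (measure_at w t) (context_at Pi C w t).

Definition traj_prob Pi x C w : R :=
  (w ord0 == x)%:R *
  \prod_(0 <= t < T)
     Q (action_at Pi C w t) (context_at Pi C w t) (w (inord t)) (w (inord t.+1)).

Definition traj_reward Pi C w : R :=
  \sum_(1 <= t < T.+1) r t (measure_at w t) (context_at Pi C w t).

(* For a given initial state only finitely many trajectories are possible, so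
   the expected reward is a finite sum. *)
Definition config_value Pi x C : R :=
  \sum_(w : trajectory T N S) traj_prob Pi x C w * traj_reward Pi C w.

(* The system is started from some configuration with empirical measure M; when
   the particles move independently, the choice is immaterial (value_empirical
   below). *)
Definition value Pi M C : R :=
  if [pick x : config N S | empirical R x == M] is Some x
  then config_value Pi x C else 0.

Definition action_value (a : nat -> A) M C : R := value (fun t _ _ => a t) M C.

Definition optimal_value M C : R := sup [set value Pi M C | Pi in [set: policy]].

End particle_system.

Section limit_system.
Variables (R : realType) (S d : nat) (A : Type).
Variable K : A -> 'rV[R]_d -> 'M[R]_S.
Variable g : 'rV[R]_d -> 'rV[R]_S -> A -> 'rV[R]_d.
Variable r : nat -> 'rV[R]_S -> 'rV[R]_d -> R.
Variable T : nat.

Definition Phi (a : A) (z : 'rV[R]_S * 'rV[R]_d) : 'rV[R]_S * 'rV[R]_d :=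
  let m' := z.1 *m K a z.2 in (m', g z.2 m' a).

Fixpoint Phis (a : nat -> A) (t : nat) z :=
  if t is s.+1 then Phi (a s) (Phis a s z) else z.

Definition limit_value (a : nat -> A) m c : R :=
  \sum_(1 <= t < T.+1) r t (Phis a t (m, c)).1 (Phis a t (m, c)).2.

Definition limit_optimal_value m c : R :=
  sup [set limit_value a m c | a in [set: nat -> A]].

End limit_system.

(* Differentiability relative to a set D that may have empty interior (such as
   the simplex): f is defined on D only, and y tends to x within D. *)
Section C1.
Variables (R : realType) (n : nat) (D : set 'rV[R]_n).

Definition gradient_on (f : 'rV[R]_n -> R) (J : 'rV[R]_n -> 'cV[R]_n) : Prop :=
  forall x, D x -> forall e : R, 0 < e ->
    \forall y \near within D (nbhs x),
      `|f y - f x - ((y - x) *m J x) ord0 ord0| <= e * `|y - x|.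

Definition C1_on (f : 'rV[R]_n -> R) : Prop :=
  exists J, {within D, continuous J} /\ gradient_on f J.

(* C^1 in x, the derivative being continuous jointly in x and the parameter a,
   which ranges over a space without differentiable structure. *)
Definition C1_on_param (A : topologicalType) (f : 'rV[R]_n -> A -> R) : Prop :=
  exists J : 'rV[R]_n -> A -> 'cV[R]_n,
    {within D `*` [set: A], continuous (fun z : 'rV[R]_n * A => J z.1 z.2)} /\
    forall a, gradient_on (f ^~ a) (J ^~ a).

End C1.

Section random_vectors.
Variables (R : realType) (n : nat).

Definition random_vector d (Omega : measurableType d) (Z : Omega -> 'rV[R]_n) :
  Prop := forall i, measurable_fun [set: Omega] (fun w => Z w ord0 i).

(* normal_prob m 0 is not the point mass at m. *)
Definition normal_law (m s : R) (B : set R) : \bar R :=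
  if s == 0 then \d_m B else normal_prob m s B.

(* Every linear combination of the components has a, possibly degenerate,
   normal law. *)
Definition gaussian_vector d (Omega : measurableType d) (P : probability Omega R)
    (G : Omega -> 'rV[R]_n) (mu : 'rV[R]_n) (Gamma : 'M[R]_n) : Prop :=
  [/\ random_vector G,
      forall u : 'cV[R]_n, exists m s : R, 0 <= s /\
        forall B : set R, measurable B ->
          P [set w | B ((G w *m u) ord0 ord0)] = normal_law m s B,
      forall i, 'E_P[fun w => G w ord0 i]%E = (mu ord0 i)%:E &
      forall i j, covariance P (fun w => G w ord0 i) (fun w => G w ord0 j)
                  = (Gamma i j)%:E].

Definition cvg_in_law d (Omega : measurableType d) (P : probability Omega R)
    d' (Omega' : measurableType d') (P' : probability Omega' R)
    (Z : nat -> Omega -> 'rV[R]_n) (G : Omega' -> 'rV[R]_n) : Prop :=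
  forall f : 'rV[R]_n -> R, continuous f ->
    (exists b : R, forall z, `|f z| <= b) ->
    ('E_P[fun w => f (Z N w)] @[N --> \oo] --> 'E_P'[fun w => f (G w)])%E.

End random_vectors.

Section exchangeability.
Variables (R : realType) (S d : nat) (A : Type).
Variable K : A -> 'rV[R]_d -> 'M[R]_S.
Variable g : 'rV[R]_d -> 'rV[R]_S -> A -> 'rV[R]_d.
Variable r : nat -> 'rV[R]_S -> 'rV[R]_d -> R.
Variables (T N : nat).
Variable Q : A -> 'rV[R]_d -> config N S -> config N S -> R.
Hypothesis QE : forall a C x y, Q a C x y = \prod_n K a C (x n) (y n).

Let relabel (s : {perm 'I_N}) (x : config N S) : config N S :=
  [ffun n => x (s n)].

Let relabelK s : cancel (relabel s) (relabel s^-1%g).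
Proof. by move=> x; apply/ffunP => n; rewrite !ffunE permKV. Qed.

Let relabelVK s : cancel (relabel s^-1%g) (relabel s).
Proof. by move=> x; apply/ffunP => n; rewrite !ffunE permK. Qed.

Let empirical_relabel s x : empirical R (relabel s x) = empirical R x.
Proof.
apply/rowP => i; rewrite !mxE [in RHS](reindex_perm s) /=.
by congr (_ * _); apply: eq_bigr => n _; rewrite ffunE.
Qed.

Let empirical_eq (x y : config N S) :
  empirical R x = empirical R y -> exists s, y = relabel s x.
Proof.
move=> /rowP xy; have [N0|N_gt0] := posnP N.
  exists 1%g; apply/ffunP => -[n nN]; exfalso.
  by rewrite N0 in nN.
have cnt i : (\sum_k (x k == i) = \sum_k (y k == i))%N.
  have := xy i; rewrite !mxE => /(mulfI _); rewrite invr_eq0 pnatr_eq0.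
  by rewrite -lt0n => /(_ N_gt0)/eqP; rewrite -!natr_sum eqr_nat => /eqP.
have : perm_eq [tuple y i | i < N] [tuple x i | i < N].
  apply/allP => i _ /=; apply/eqP; rewrite -!sumn_count !sumnE !big_map.
  by rewrite -!enumT !big_enum /= cnt.
move=> /tuple_permP[s ys]; exists s; apply/ffunP => k; rewrite ffunE.
have := congr1 (nth (x k) ^~ k) ys.
by rewrite -!tnth_nth; do ?rewrite !tnth_mktuple.
Qed.

Lemma config_value_empirical (Pi : policy R S d A) (x y : config N S) C :
  empirical R x = empirical R y ->
  config_value g r T Q Pi x C = config_value g r T Q Pi y C :> R.
Proof.
move=> /empirical_eq[s ->].
pose h (w : trajectory T N S) : trajectory T N S := [ffun t => relabel s (w t)].
have hbij : bijective h.
  exists (fun w : trajectory T N S => [ffun t => relabel s^-1%g (w t)]) => w;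
  by apply/ffunP => t; rewrite !ffunE ?relabelK ?relabelVK.
have hm w t : measure_at R (h w) t = measure_at R w t.
  by rewrite /measure_at ffunE empirical_relabel.
have hc w t : context_at g Pi C (h w) t = context_at g Pi C w t.
  by elim: t => //= t ->; rewrite !hm.
rewrite [RHS](reindex h) /=; last exact: onW_bij.
apply: eq_bigr => w _; congr (_ * _); last first.
  by apply: eq_bigr => t _; rewrite hm hc.
rewrite /traj_prob; congr (_ * _).
  by rewrite ffunE (can_eq (relabelK s)).
apply: eq_bigr => t _; rewrite /action_at hm hc !QE (reindex_perm s) /=.
by apply: eq_bigr => n _; rewrite !ffunE.
Qed.

Lemma value_empirical (Pi : policy R S d A) (x : config N S) C :
  value g r T Q Pi (empirical R x) C = config_value g r T Q Pi x C :> R.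
Proof.
rewrite /value; case: pickP => [y /eqP yx|/(_ x)]; last by rewrite eqxx.
exact: config_value_empirical.
Qed.

End exchangeability.

(* Main.v *)
Require Import Defs.
From HB Require Import structures.
From mathcomp Require Import all_boot all_order all_algebra.
From mathcomp Require Import all_classical all_reals all_analysis.
From mathcomp Require Import measurable_realfun ring lra.
Set Implicit Arguments.
Unset Strict Implicit.
Unset Printing Implicit Defensive.
Import Order.TTheory GRing.Theory Num.Theory.
Import numFieldNormedType.Exports.
Local Open Scope classical_set_scope.
Local Open Scope ring_scope.

(* Given the configuration x, the next empirical measure has mean
   empirical x *m K and deviates from it by O(1 / sqrt N) in L^1. All data being
   Lipschitz on compact sets, uniformly in the action, backward induction on the
   horizon gives V^N_a = v_a + O(1 / sqrt N) for every fixed action sequence a,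
   and V^N_Pi <= v* + O(1 / sqrt N) for every policy Pi, uniformly over initial
   contexts in a ball. Moreover v_a and v* are Lipschitz in the initial state. So
   V* and V_astar both lie within e_N of v*(m0, c0), where sqrt N * e_N =
   beta |sqrt N ((M_0, C_0) - (m0, c0))| + gamma, and the portmanteau theorem for
   closed sets finishes the proof.
   A measure is only controlled on measurable sets, so V* must be shown to be a
   measurable function of the initial state: by dynamic programming it is
   Lipschitz in the context for each of the finitely many initial measures. *)

(** * Matrix norms and Lipschitz bounds *)

(** The comparison is one-sided for policies. A fixed action sequence is tracked from both sides by
    its limit, whereas a policy may perform badly and is only bounded above; the lower bound on V*
    comes from playing [astar] blindly, which is itself a policy. Hence v* - e_N <= V_astar <= V* <=
    v* + e_N. Reacting to the fluctuations gains only O(1 / sqrt N), because the one-step error has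
    the same constant for every action: the derivatives are jointly continuous in state and action,
    and the action set is compact. Lipschitz constants exist on bounded sets of contexts only. This
    is why [loc_lip] also records a bound: [g] sends the ball of radius B into a ball of radius Lg,
    on which the rest of the horizon is treated, so every induction keeps B quantified inside. The
    obstacle to measurability is that a policy is an arbitrary map: V^N_Pi may be discontinuous,
    even non-measurable, in the context, and V* is not given as a supremum of regular functions. The
    Bellman recursion instead takes suprema over actions of functions that share one Lipschitz
    constant. *)

Section matrix_norm.
Variable R : realType.

Lemma mx_entry_le m n (x : 'M[R]_(m, n)) i j : `|x i j| <= `|x|.
Proof.
by rewrite [leRHS]/Num.norm /= mx_normrE; apply: (le_bigmax _ _ (i, j)).
Qed.

Lemma mx_norm_leP m n (x : 'M[R]_(m, n)) (b : R) :
  0 <= b -> (forall i j, `|x i j| <= b) -> `|x| <= b.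
Proof.
move=> b0 xb; rewrite [leLHS]/Num.norm /= mx_normrE.
by apply: bigmax_le => // -[i j] _; exact: xb.
Qed.

(** The norm of a matrix is its largest entry in absolute value, not an operator norm; hence the
    factor [n]. *)
Lemma mulmx_norm_le m n p (x : 'M[R]_(m, n)) (y : 'M[R]_(n, p)) :
  `|x *m y| <= n%:R * (`|x| * `|y|).
Proof.
apply: mx_norm_leP => [|i j]; first by rewrite !mulr_ge0.
rewrite mxE (le_trans (ler_norm_sum _ _ _))//.
rewrite -[n in n%:R]card_ord mulr_natl -sumr_const ler_sum// => k _.
by rewrite normrM ler_pM// mx_entry_le.
Qed.

Lemma row_mx_norm_le m1 m2 (x : 'rV[R]_m1) (y : 'rV[R]_m2) (b : R) :
  `|x| <= b -> `|y| <= b -> `|row_mx x y| <= b.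
Proof.
move=> xb yb; apply: mx_norm_leP => [|i j]; first exact: le_trans yb.
by rewrite mxE; case: (fintype.split j) => k; apply: le_trans (mx_entry_le _ _ _) _.
Qed.

Lemma row_mx_norm_ge m1 m2 (x : 'rV[R]_m1) (y : 'rV[R]_m2) :
  `|x| <= `|row_mx x y| /\ `|y| <= `|row_mx x y|.
Proof.
split; apply: mx_norm_leP => // i j.
  by have := mx_entry_le (row_mx x y) i (lshift m2 j); rewrite row_mxEl.
by have := mx_entry_le (row_mx x y) i (rshift m1 j); rewrite row_mxEr.
Qed.

End matrix_norm.

Section lipschitz.
Variable R : realType.

(** Mean value theorem for [f] along the segment from [x] to [y]. As [D] may have empty interior,
    increments are only taken between points of this segment. *)
Lemma gradient_on_lipschitz n (D : set 'rV[R]_n) f J (L : R) x y :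
  gradient_on D f J ->
  (forall s : R, 0 <= s <= 1 ->
     D (x + s *: (y - x)) /\ `|J (x + s *: (y - x))| <= L) ->
  `|f y - f x| <= n%:R * L * `|y - x|.
Proof.
move=> gradJ xyD; set v := y - x.
pose z (s : R) := x + s *: v.
pose phi s := f (z s); pose dphi s := (v *m J (z s)) ord0 ord0.
have gradE s e : 0 <= s <= 1 -> 0 < e -> exists2 h0 : R, 0 < h0 &
    forall h, `|h| < h0 -> 0 <= s + h <= 1 ->
    `|phi (s + h) - phi s - h * dphi s| <= e * `|h|.
  (* The added 1 keeps the denominators positive when [v] is zero. *)
  move=> s01 e0; have v0 : 0 < `|v| + 1 by rewrite ltr_wpDl.
  have e'0 : 0 < e / (`|v| + 1) by rewrite divr_gt0.
  have /= := gradJ _ (xyD _ s01).1 _ e'0.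
  move=> /nbhs_ballP[d /= d0 dP]; exists (d / (`|v| + 1)); first exact: divr_gt0.
  move=> h hd sh; have zE : z (s + h) - z s = h *: v.
    by rewrite /z scalerDl opprD addrACA subrr add0r addrC addKr.
  have := dP (z (s + h)); rewrite -ball_normE /=.
  move=> /(_ _ (xyD _ sh).1); rewrite -/(z s) -/(phi s) -/(phi (s + h)) zE.
  rewrite -scalemxAl mxE => /(_ _)/le_trans; apply.
    rewrite -normrN opprB zE normrZ.
    rewrite (@le_lt_trans _ _ (`|h| * (`|v| + 1)))//.
      by rewrite ler_wpM2l// lerDl.
    by rewrite -ltr_pdivlMr.
  rewrite normrZ [leLHS](_ : _ = e * `|h| * (`|v| / (`|v| + 1))); last by ring.
  by rewrite ler_piMr ?mulr_ge0 ?(ltW e0)// ler_pdivrMr// mul1r lerDl.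
have dphi_bound s : 0 <= s <= 1 -> `|dphi s| <= n%:R * L * `|v|.
  move=> s01; apply: le_trans (mx_entry_le _ _ _) _.
  apply: le_trans (mulmx_norm_le _ _) _.
  by rewrite -mulrA ler_wpM2l// mulrC ler_wpM2r// (xyD _ s01).2.
have [c c01 phi10] : exists2 c, c \in `[0, 1]%R &
    phi 1 - phi 0 = dphi c * (1 - 0).
  apply: MVT_segment => // [s s01|].
    have {}s01 : 0 < s < 1 by move: s01; rewrite in_itv.
    have : h^-1 *: (phi (h *: 1 + s) - phi s) @[h --> (0:R)^'] --> dphi s.
      apply/cvgrPdist_le => e e0.
      have [|h0 h00 h0P] := gradE s e _ e0.
        by case/andP : s01 => ? ?; rewrite !ltW.
      (* Staying below [s] and [1 - s] keeps [s + h] in the unit interval. *)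
      have m0 : 0 < Num.min h0 (Num.min s (1 - s)).
        by rewrite !lt_min h00/= subr_gt0.
      near=> h.
      have hn0 : h != 0 by near: h; exact: nbhs_dnbhs_neq.
      have : `|h| < Num.min h0 (Num.min s (1 - s)).
        near: h; apply: dnbhs0_lt => //.
      rewrite !lt_min => /and3P[hh0 hs h1s].
      have H : `|phi (s + h) - phi s - h * dphi s| <= e * `|h|.
        apply: h0P => //.
        move: hs h1s; rewrite !ltr_norml => /andP[? ?] /andP[? ?].
        by apply/andP; split; lra.
      rewrite distrC -(@ler_pM2l _ `|h|) ?normr_gt0// -normrM mulrBr.
      by rewrite [h *: _]mulr1 [h + s]addrC -[_ *: _]/(_ * _) mulVKf// [_ * e]mulrC.
    move=> /[dup] cvgd /cvg_lim dE; split; last exact: dE.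
    by apply/cvg_ex; exists (dphi s).
  apply/subspace_continuousP => s; rewrite /= in_itv/= => s01.
  apply/cvgrPdist_le => e e0.
  (* With error 1 in the expansion and the bound on [dphi], [phi] varies by at most (1 + n L |v|) |t
     - s| near [s], endpoints included. *)
  have [h0 h00 h0P] := gradE s 1 s01 ltr01.
  have B0 : 0 < n%:R * L * `|v| + 1.
    by rewrite ltr_wpDl// (le_trans _ (dphi_bound _ s01)).
  have m0 : 0 < Num.min h0 (e / (n%:R * L * `|v| + 1)).
    by rewrite lt_min h00 divr_gt0.
  apply/nbhs_ballP; exists (Num.min h0 (e / (n%:R * L * `|v| + 1))) => // t.
  rewrite /ball /= lt_min distrC ltr_pdivlMr// => /andP[th0 te].
  rewrite in_itv/= => t01.
  have := h0P _ th0; rewrite subrKC => /(_ t01); rewrite mul1r => H.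
  rewrite distrC -[phi t - _](subrK ((t - s) * dphi s)).
  rewrite (le_trans (ler_normD _ _))// (le_trans _ (ltW te))//.
  rewrite mulrDr mulr1 addrC lerD// normrM ler_wpM2l// dphi_bound//.
move: phi10; rewrite /phi /z scale1r scale0r addr0 subrKC subr0 mulr1 => ->.
by apply: dphi_bound; move: c01; rewrite in_itv.
Unshelve. all: by end_near. Qed.

Lemma locally_lipschitz_continuous (V W : normedModType R) (f : V -> W) :
  (forall x, exists2 L : R, 0 <= L &
     forall y, `|x - y| < 1 -> `|f x - f y| <= L * `|x - y|) ->
  continuous f.
Proof.
move=> lf x; have [L L0 lL] := lf x.
apply/(@cvgrPdist_le _ _ _ (nbhs x) (nbhs_filter x)) => e e0.
have m0 : 0 < Num.min 1 (e / (L + 1)).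
  by rewrite lt_min ltr01 divr_gt0// ltr_wpDl.
apply/nbhs_ballP; exists (Num.min 1 (e / (L + 1))) => // y.
rewrite -ball_normE /= lt_min => /andP[xy1 xye].
rewrite (le_trans (lL _ xy1))// (@le_trans _ _ (L * (e / (L + 1))))//.
  by rewrite ler_wpM2l// ltW.
rewrite mulrA ler_pdivrMr ?ltr_wpDl// mulrC ler_wpM2l ?(ltW e0)//.
by rewrite lerDl.
Qed.

Lemma continuous_compact_bounded (T : topologicalType) (V : normedModType R)
    (D X : set T) (f : T -> V) :
  {within D, continuous f} -> X `<=` D -> compact X ->
  exists2 L : R, 0 < L & forall x, X x -> `|f x| <= L.
Proof.
move=> cf XD cX; have cfX := continuous_subspaceW XD cf.
have /compact_bounded/ex_strict_bound_gt0[L L0 LP] := continuous_compact cfX cX.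
by exists L => // x Xx; apply/ltW/LP; exists x.
Qed.

Section C1.
Variables (n : nat) (D X : set 'rV[R]_n).
Hypotheses (XD : X `<=` D) (cX : compact X).
Hypothesis convX : forall x y (s : R), X x -> X y -> 0 <= s <= 1 ->
  X (x + s *: (y - x)).

(** The gradient is jointly continuous, hence bounded on the compact product of [X] and [A]; this
    makes the constant independent of the action. *)
Lemma C1_on_param_lipschitz (A : topologicalType) (f : 'rV[R]_n -> A -> R) :
  compact [set: A] -> C1_on_param D f ->
  exists2 L : R, 0 <= L &
    forall a x y, X x -> X y -> `|f y a - f x a| <= L * `|y - x|.
Proof.
move=> cA [J [cJ gJ]].
have XAD : X `*` [set: A] `<=` D `*` [set: A] by move=> -[x a] /= [/XD].
have [L L0 LP] := continuous_compact_bounded cJ XAD (compact_setX cX cA).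
exists (n%:R * L) => [|a x y Xx Xy]; first by rewrite mulr_ge0// ltW.
apply: gradient_on_lipschitz (gJ a) _ => s s01; have Xs := convX Xx Xy s01.
by split; [exact: XD|apply: (LP (_, a))].
Qed.

Lemma C1_on_lipschitz (f : 'rV[R]_n -> R) : C1_on D f ->
  exists2 L : R, 0 <= L & forall x y, X x -> X y -> `|f y - f x| <= L * `|y - x|.
Proof.
move=> [J [cJ gJ]]; have [L L0 LP] := continuous_compact_bounded cJ XD cX.
exists (n%:R * L) => [|x y Xx Xy]; first by rewrite mulr_ge0// ltW.
apply: gradient_on_lipschitz gJ _ => s s01; have Xs := convX Xx Xy s01.
by split; [exact: XD|exact: LP].
Qed.

End C1.

End lipschitz.

(** * Deviation of the empirical measure in one jump *)

Section product_expectation.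
Variables (R : realType) (S N : nat).
Implicit Types (p Z : 'I_N -> 'I_S -> R).

Lemma sum_prod_config p :
  \sum_(y : config N S) \prod_n p n (y n) = \prod_n \sum_v p n v.
Proof. by rewrite bigA_distr_bigA. Qed.

(** Under a product law, the two factors can be absorbed into the weights of particles [n] and [m];
    the sum then splits into a product whose [n]-th factor is zero. *)
Lemma expectation_cross p Z n m : n != m -> \sum_v p n v * Z n v = 0 ->
  \sum_(y : config N S) (\prod_k p k (y k)) * (Z n (y n) * Z m (y m)) = 0.
Proof.
move=> nm Zn0.
pose q k v := p k v * ((if k == n then Z n v else 1) *
                       (if k == m then Z m v else 1)).
transitivity (\sum_(y : config N S) \prod_k q k (y k)).
  apply: eq_bigr => y _; rewrite [RHS]big_split/=; congr (_ * _).
  by rewrite big_split/= -!big_mkcond/= !big_pred1_eq.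
rewrite sum_prod_config (bigD1 n)//= [X in X * _](_ : _ = 0) ?mul0r//.
rewrite -[RHS]Zn0; apply: eq_bigr => v _.
by rewrite /q eqxx (negbTE nm) mulr1.
Qed.

(** Independent centred variables are uncorrelated, so only the [N] diagonal terms remain, each at
    most 1. *)
Lemma expectation_sum_sqr p Z : (forall n v, 0 <= p n v) ->
  (forall n, \sum_v p n v = 1) -> (forall n, \sum_v p n v * Z n v = 0) ->
  (forall n v, `|Z n v| <= 1) ->
  \sum_(y : config N S) (\prod_k p k (y k)) * (\sum_n Z n (y n)) ^+ 2 <= N%:R.
Proof.
move=> p0 p1 Z0 Z1.
under eq_bigr do rewrite expr2 mulr_suml mulr_sumr.
rewrite exchange_big/= -[N in N%:R]card_ord -sumr_const ler_sum// => n _.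
under eq_bigr do rewrite mulr_sumr mulr_sumr.
rewrite exchange_big/= (bigD1 n)//= [X in _ + X]big1 ?addr0; last first.
  by move=> m mn; apply: expectation_cross => //; rewrite eq_sym.
rewrite -[leRHS](_ : \sum_(y : config N S) \prod_k p k (y k) = 1); last first.
  by rewrite sum_prod_config big1.
apply: ler_sum => y _; rewrite ler_piMr ?prodr_ge0//.
by rewrite -expr2 -real_normK ?num_real// expr_le1.
Qed.

End product_expectation.

Section one_step.
Variables (R : realType) (S N : nat) (k : 'M[R]_S).
Hypothesis N_gt0 : (0 < N)%N.
Hypothesis k_kernel : transition_kernel k.

Lemma simplex_empirical (x : config N S) : simplex (empirical R x).
Proof.
split=> [i|]; first by rewrite mxE mulr_ge0 ?invr_ge0// sumr_ge0.
under eq_bigr do rewrite mxE.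
rewrite -mulr_sumr exchange_big/=.
under eq_bigr => n _.
  rewrite (bigD1 (x n))//= eqxx big1 ?addr0; last first.
    by move=> i; rewrite eq_sym => /negbTE ->.
  over.
by rewrite sumr_const card_ord mulVf// pnatr_eq0 -lt0n.
Qed.

Lemma simplex_mulmx (m : 'rV[R]_S) : simplex m -> simplex (m *m k).
Proof.
move=> [m0 m1]; split=> [i|].
  by rewrite mxE sumr_ge0// => j _; rewrite mulr_ge0// k_kernel.1.
under eq_bigr do rewrite mxE.
rewrite exchange_big/= -[RHS]m1; apply: eq_bigr => i _.
by rewrite -mulr_sumr k_kernel.2 mulr1.
Qed.

Lemma sum_prod_kernel (x : config N S) :
  \sum_(y : config N S) \prod_n k (x n) (y n) = 1.
Proof.
by rewrite (sum_prod_config (fun n => k (x n))) big1// => n _; rewrite k_kernel.2.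
Qed.

(** This identifies [empirical R x *m k] as the mean of the next empirical measure, so that the
    deviation is an average of independent centred terms. *)
Lemma empirical_mulmx (x : config N S) j :
  (empirical R x *m k) ord0 j = N%:R^-1 * \sum_n k (x n) j.
Proof.
rewrite mxE; under eq_bigr do rewrite mxE -mulrA mulr_suml.
rewrite -mulr_sumr exchange_big/=; congr (_ * _); apply: eq_bigr => n _.
rewrite (bigD1 (x n))//= eqxx mul1r big1 ?addr0// => i.
by rewrite eq_sym => /negbTE ->; rewrite mul0r.
Qed.

Lemma kernel_le1 i j : k i j <= 1.
Proof.
rewrite -(k_kernel.2 i) (bigD1 j)//= lerDl sumr_ge0// => l _.
exact: k_kernel.1.
Qed.

(* With weight sqrt N, AM-GM bounds each coordinate D of the deviation by
   (sqrt N D^2 + 1 / sqrt N) / 2, so that a variance bound suffices. *)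
Lemma expected_deviation (x : config N S) :
  \sum_(y : config N S) (\prod_n k (x n) (y n)) *
     `|empirical R y - empirical R x *m k| <= S%:R / Num.sqrt N%:R.
Proof.
pose D (y : config N S) j := (empirical R y - empirical R x *m k) ord0 j.
have Q0 (y : config N S) : 0 <= \prod_n k (x n) (y n).
  by rewrite prodr_ge0// => n _; exact: k_kernel.1.
have N0 : 0 < Num.sqrt (N%:R : R) by rewrite sqrtr_gt0 ltr0n.
have sqrtN : Num.sqrt (N%:R : R) ^+ 2 = N%:R by rewrite sqr_sqrtr.
have D2 j : \sum_(y : config N S) (\prod_n k (x n) (y n)) * D y j ^+ 2 <= N%:R^-1.
  (* The centred indicator that particle [n] lands in [j]. Coordinate [j] of the deviation is the
     average of these, so its second moment is at most N / N^2. *)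
  pose Z n v : R := (v == j)%:R - k (x n) j.
  have DE y : D y j = N%:R^-1 * \sum_n Z n (y n).
    rewrite /D mxE [X in _ + X]mxE empirical_mulmx mxE -mulrBr -sumrB.
    by congr (_ * _).
  under eq_bigr do rewrite DE exprMn mulrCA.
  rewrite -mulr_sumr exprVn ler_pdivrMl ?exprn_gt0 ?ltr0n//.
  rewrite expr2 mulfK ?pnatr_eq0 -?lt0n//.
  apply: (@expectation_sum_sqr _ _ _ (fun n => k (x n)) Z) => [n v|n|n|n v].
  - exact: k_kernel.1.
  - exact: k_kernel.2.
  - under eq_bigr do rewrite mulrBr.
    rewrite sumrB -mulr_suml k_kernel.2 mul1r (bigD1 j)//= eqxx mulr1.
    by rewrite big1 ?addr0 ?subrr// => v /negbTE ->; rewrite mulr0.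
  - have := kernel_le1 (x n) j; have := k_kernel.1 (x n) j.
    rewrite /Z ler_norml => k0 k1.
    by case: (v == j); rewrite ?mulr1n ?mulr0n; apply/andP; split; lra.
have F0 y j : 0 <= (Num.sqrt N%:R * D y j ^+ 2 + (Num.sqrt N%:R)^-1) / 2.
  apply: divr_ge0 => //; apply: addr_ge0; last by rewrite invr_ge0 ltW.
  by apply: mulr_ge0; [exact: ltW|exact: sqr_ge0].
(* The maximum over the coordinates is bounded by their sum, which costs the factor [S]. *)
apply: (@le_trans _ _ (\sum_(y : config N S) (\prod_n k (x n) (y n)) *
    \sum_j (Num.sqrt N%:R * D y j ^+ 2 + (Num.sqrt N%:R)^-1) / 2)).
  apply: ler_sum => y _; rewrite ler_wpM2l//.
  apply: mx_norm_leP => [|i j]; last rewrite ord1.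
    by apply: sumr_ge0 => j _; exact: F0.
  rewrite (bigD1 j)//= ler_wpDr//.
    by apply: sumr_ge0 => l _; exact: F0.
  rewrite -/(D y j); set q := Num.sqrt _ in N0 *.
  rewrite ler_pdivlMr// -subr_ge0.
  rewrite [X in 0 <= X](_ : _ = q * (`|D y j| - q^-1) ^+ 2);
    first by rewrite mulr_ge0 ?sqr_ge0 ?ltW.
  rewrite -[D y j ^+ 2]real_normK ?num_real//.
  by field; rewrite gt_eqF.
under eq_bigr do rewrite mulr_sumr.
rewrite exchange_big/=.
have -> : S%:R / Num.sqrt N%:R = \sum_(j < S) (Num.sqrt N%:R)^-1 :> R.
  by rewrite sumr_const card_ord mulr_natl.
apply: ler_sum => j _.
under eq_bigr do rewrite mulrA mulrDr mulrCA.
rewrite -mulr_suml big_split/= -mulr_sumr -mulr_suml sum_prod_kernel mul1r.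
rewrite ler_pdivrMr// mulr_natr mulr2n lerD2r.
rewrite (le_trans (ler_wpM2l (ltW N0) (D2 j)))//.
move: N0 sqrtN; set q := Num.sqrt _ => N0 <-.
by rewrite expr2 invfM mulrA mulfV ?gt_eqF// mul1r.
Qed.

End one_step.

(** * Decomposition of the values at the first step *)

Section first_step.
Variables (R : realType) (S d : nat) (A : Type).
Variable g : 'rV[R]_d -> 'rV[R]_S -> A -> 'rV[R]_d.
Variable N : nat.
Variable Q : A -> 'rV[R]_d -> config N S -> config N S -> R.
Implicit Types (Pi : policy R S d A) (x y : config N S) (C : 'rV[R]_d).

Definition tail_policy Pi : policy R S d A := fun t => Pi t.+1.

Definition traj_cons T x (w : trajectory T N S) : trajectory T.+1 N S :=
  [ffun i => oapp w x (unlift ord0 i)].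

Lemma traj_cons0 T x (w : trajectory T N S) : traj_cons x w ord0 = x.
Proof. by rewrite ffunE unlift_none. Qed.

Lemma inord_lift0 T t : (t <= T)%N ->
  inord t.+1 = lift ord0 (inord t : 'I_T.+1) :> 'I_T.+2.
Proof. by move=> tT; apply: val_inj; rewrite /= !inordK. Qed.

Lemma inord0 T : inord 0 = ord0 :> 'I_T.+1.
Proof. by apply: val_inj; rewrite /= inordK. Qed.

Lemma traj_consS T x (w : trajectory T N S) t : (t <= T)%N ->
  traj_cons x w (inord t.+1) = w (inord t).
Proof. by move=> tT; rewrite inord_lift0// ffunE liftK. Qed.

Lemma big_traj_cons T (F : trajectory T.+1 N S -> R) :
  \sum_w F w = \sum_x \sum_w F (traj_cons x w).
Proof.
rewrite pair_big/= (reindex (fun p => traj_cons p.1 p.2))//=.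
exists (fun w => (w ord0, [ffun i => w (lift ord0 i)])) => [[x w] _|w _] /=.
  rewrite traj_cons0; congr (_, _); apply/ffunP => i.
  by rewrite !ffunE liftK.
apply/ffunP => i; rewrite ffunE.
case: unliftP => [j ->|->] //=.
by rewrite ffunE.
Qed.

Lemma measure_at_consS T x (w : trajectory T N S) t : (t <= T)%N ->
  measure_at R (traj_cons x w) t.+1 = measure_at R w t.
Proof. by move=> tT; rewrite /measure_at traj_consS. Qed.

Lemma measure_at_cons0 T x (w : trajectory T N S) :
  measure_at R (traj_cons x w) 0 = empirical R x.
Proof. by rewrite /measure_at inord0 traj_cons0. Qed.

Lemma context_atS T Pi C (w : trajectory T N S) t :
  context_at g Pi C w t.+1 =
  g (context_at g Pi C w t) (measure_at R w t.+1) (action_at g Pi C w t).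
Proof. by []. Qed.

Section cons.
Variables (Pi : policy R S d A) (x : config N S) (C : 'rV[R]_d).
Let a := Pi 0 (empirical R x) C.
Let next y := g C (empirical R y) a.

Lemma context_at_consS T (w : trajectory T N S) t : (t <= T)%N ->
  context_at g Pi C (traj_cons x w) t.+1 =
  context_at g (tail_policy Pi) (next (w ord0)) w t.
Proof.
elim: t => [_|t IH tT].
  by rewrite /= measure_at_consS// measure_at_cons0 /measure_at inord0.
rewrite [LHS]context_atS [RHS]context_atS /action_at IH ?(ltnW tT)//.
by rewrite !measure_at_consS// ltnW.
Qed.

Lemma traj_prob_cons T (w : trajectory T N S) :
  traj_prob g Q Pi x C (traj_cons x w) =
  Q a C x (w ord0) *
  traj_prob g Q (tail_policy Pi) (w ord0) (next (w ord0)) w.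
Proof.
rewrite /traj_prob traj_cons0 !eqxx !mul1r big_nat_recl//.
congr (_ * _).
  by rewrite /action_at measure_at_cons0 inord0 traj_cons0 traj_consS// inord0.
apply: eq_big_nat => t /andP[_ tT]; have tT' := ltnW tT.
by rewrite /action_at context_at_consS// measure_at_consS// !traj_consS.
Qed.

(** Stated for an arbitrary functional [F] so as to give both the total mass and the expected
    reward. The indicator of the initial configuration in [traj_prob] selects [y = w ord0]. *)
Lemma sum_traj_prob T (F : trajectory T.+1 N S -> R) :
  \sum_w traj_prob g Q Pi x C w * F w =
  \sum_y Q a C x y * \sum_w
    traj_prob g Q (tail_policy Pi) y (next y) w * F (traj_cons x w).
Proof.
rewrite big_traj_cons (bigD1 x)//= [X in _ + X]big1 ?addr0; last first.
  move=> y /negbTE yx; rewrite big1// => w _.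
  by rewrite /traj_prob traj_cons0 yx !mul0r.
under [RHS]eq_bigr do rewrite mulr_sumr.
rewrite exchange_big/=; apply: eq_bigr => w _.
rewrite traj_prob_cons (bigD1 (w ord0))//= big1 ?addr0 ?mulrA// => y.
by rewrite eq_sym => /negbTE yw; rewrite /traj_prob yw !(mul0r, mulr0).
Qed.

End cons.

Hypothesis Q1 : forall a C x, \sum_y Q a C x y = 1.

Lemma sum_traj_prob1 T Pi x C :
  \sum_(w : trajectory T N S) traj_prob g Q Pi x C w = 1.
Proof.
elim: T Pi x C => [|T IH] Pi x C.
  rewrite (bigD1 [ffun => x])//= /traj_prob big_geq// ffunE eqxx mulr1.
  rewrite big1 ?addr0// => w wx; rewrite big_geq// mulr1.
  case: eqP => // wx0; move/eqP : wx; case; apply/ffunP => i.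
  by rewrite ffunE ord1.
under eq_bigr do rewrite -[traj_prob _ _ _ _ _ _]mulr1.
rewrite sum_traj_prob -[RHS](Q1 (Pi 0 (empirical R x) C) C x).
apply: eq_bigr => y _; under eq_bigr do rewrite mulr1.
by rewrite IH mulr1.
Qed.

Lemma config_value0 r Pi x C : config_value g r 0 Q Pi x C = 0.
Proof.
by rewrite /config_value big1// => w _; rewrite /traj_reward big_geq// mulr0.
Qed.

(** Markov property: after the first jump the system restarts at time 0 from [y], with policy and
    rewards shifted by one. Every induction on the horizon for the particle system rests on this
    identity. *)
Lemma config_valueS r T Pi x C :
  let a := Pi 0 (empirical R x) C in
  config_value g r T.+1 Q Pi x C =
  \sum_y Q a C x y * (r 1 (empirical R y) (g C (empirical R y) a) +
     config_value g (fun t => r t.+1) T Q (tail_policy Pi) y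
       (g C (empirical R y) a)).
Proof.
move=> a; rewrite /config_value sum_traj_prob; apply: eq_bigr => y _.
(* The first reward is multiplied by the total mass 1 of the later trajectories, which brings both
   terms under one sum. *)
congr (_ * _); rewrite -[r 1%N _ _]mul1r.
rewrite -(sum_traj_prob1 T (tail_policy Pi) y (g C (empirical R y) a)).
rewrite mulr_suml -big_split/=; apply: eq_bigr => w _; rewrite -mulrDr.
have [wy|wy] := eqVneq (w ord0) y; last first.
  by rewrite /traj_prob (negbTE wy) !mul0r.
congr (_ * _); rewrite /traj_reward big_add1 big_nat_recl//; congr (_ + _).
  rewrite context_at_consS//.
  by rewrite measure_at_consS// /measure_at inord0 wy.
rewrite big_add1; apply: eq_big_nat => t /andP[_ tT].
rewrite context_at_consS//.
by rewrite measure_at_consS// wy.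
Qed.

End first_step.

(** * Comparison with the limit system *)

Section sup_range.
Variables (R : realType) (I : Type) (i0 : I).
Implicit Types f h : I -> R.

Lemma sup_range_le f b : (forall i, f i <= b) -> sup [set f i | i in setT] <= b.
Proof.
by move=> fb; apply: ge_sup => [|_ [i _ <-]//]; exists (f i0), i0.
Qed.

Lemma le_sup_range f b i : (forall i, f i <= b) ->
  f i <= sup [set f i | i in setT].
Proof.
by move=> fb; apply: ub_le_sup; [exists b => _ [j _ <-]|exists i].
Qed.

Lemma sup_range_adherent f b e : (forall i, f i <= b) -> 0 < e ->
  exists i, sup [set f i | i in setT] - e < f i.
Proof.
move=> fb e0; have [|_ [i _ <-] fi] := @sup_adherent _ [set f i | i in setT] _ e0.
  by split; [exists (f i0), i0|exists b => _ [j _ <-]].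
by exists i.
Qed.

(** The supremum is nonexpansive. The bounds exclude unbounded ranges, where [sup] is a default
    value. *)
Lemma sup_range_dist f h b e : (forall i, `|f i| <= b) ->
  (forall i, `|h i| <= b) -> (forall i, `|f i - h i| <= e) ->
  `|sup [set f i | i in setT] - sup [set h i | i in setT]| <= e.
Proof.
move=> fb hb fhe; have le_b (k : I -> R) : (forall i, `|k i| <= b) -> forall i, k i <= b.
  by move=> kb i; rewrite (le_trans (ler_norm _)).
rewrite ler_distl; apply/andP; split.
  rewrite lerBlDr; apply: sup_range_le => i.
  rewrite -lerBlDr (le_trans _ (le_sup_range i (le_b _ fb)))//.
  by have := fhe i; rewrite ler_distl => /andP[].
apply: sup_range_le => i; rewrite -lerBlDr.
apply: le_trans (le_sup_range i (le_b _ hb)).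
by rewrite lerBlDr; have := fhe i; rewrite ler_distl => /andP[].
Qed.

Lemma sup_range_norm f b : (forall i, `|f i| <= b) ->
  `|sup [set f i | i in setT]| <= b.
Proof.
move=> fb; rewrite ler_norml; apply/andP; split.
  have := fb i0; rewrite ler_norml => /andP[/le_trans + _]; apply.
  by apply: (@le_sup_range _ b) => i; rewrite (le_trans (ler_norm _)).
by apply: sup_range_le => i; rewrite (le_trans (ler_norm _)).
Qed.

End sup_range.

Section loc_lip.
Variables (R : realType) (S d : nat).
Local Notation meas := 'rV[R]_S.
Local Notation ctx := 'rV[R]_d.

(* Uniformly in the index i, which is typically an action or a sequence of
   actions. *)
Definition loc_lip (V : normedModType R) (I : Type) (F : I -> meas -> ctx -> V) :=
  forall B : R, exists L : R, [/\ 0 <= L,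
    forall i m1 m2 c1 c2, simplex m1 -> simplex m2 -> `|c1| <= B -> `|c2| <= B ->
      `|F i m1 c1 - F i m2 c2| <= L * (`|m1 - m2| + `|c1 - c2|) &
    forall i m c, simplex m -> `|c| <= B -> `|F i m c| <= L].

Lemma loc_lip_reindex (V : normedModType R) (I J : Type) (h : J -> I)
    (F : I -> meas -> ctx -> V) :
  loc_lip F -> loc_lip (F \o h).
Proof. by move=> lF B; have [L [L0 lL bL]] := lF B; exists L; split => // i; eauto. Qed.

Lemma loc_lip0 (V : normedModType R) (I : Type) :
  loc_lip (fun (_ : I) _ _ => 0 : V).
Proof.
by move=> B; exists 0; split => // *; rewrite ?subrr ?mul0r normr0.
Qed.

Lemma loc_lipD (V : normedModType R) (I : Type) (F G : I -> meas -> ctx -> V) :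
  loc_lip F -> loc_lip G -> loc_lip (fun i m c => F i m c + G i m c).
Proof.
move=> lF lG B; have [L [L0 lL bL]] := lF B; have [M [M0 lM bM]] := lG B.
exists (L + M); split => [|i m1 m2 c1 c2 *|i m c *]; first exact: addr_ge0.
  by rewrite opprD addrACA mulrDl (le_trans (ler_normD _ _))// lerD ?lL ?lM.
by rewrite (le_trans (ler_normD _ _))// lerD ?bL ?bM.
Qed.

Lemma loc_lip_sup (I : Type) (i0 : I) (F : I -> meas -> ctx -> R) :
  loc_lip F -> loc_lip (fun (_ : unit) m c => sup [set F i m c | i in setT]).
Proof.
move=> lF B; have [L [L0 lL bL]] := lF B; exists L; split => // [_|_].
  move=> m1 m2 c1 c2 m1S m2S c1B c2B.
  by apply: (@sup_range_dist _ _ i0 _ _ L) => i; [exact: bL|exact: bL|exact: lL].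
by move=> m c mS cB; apply: (sup_range_norm i0) => i; exact: bL.
Qed.

Lemma simplex_norm_le1 (m : meas) : simplex m -> `|m| <= 1.
Proof.
move=> [m0 m1]; apply: mx_norm_leP => // i j; rewrite ord1 ger0_norm//.
by rewrite -m1 (bigD1 j)//= lerDl sumr_ge0.
Qed.

End loc_lip.

Section limit_dynamics.
Variables (R : realType) (S d : nat) (A : Type).
Variable K : A -> 'rV[R]_d -> 'M[R]_S.
Variable g : 'rV[R]_d -> 'rV[R]_S -> A -> 'rV[R]_d.
Hypothesis K_kernel : forall a C, transition_kernel (K a C).
Hypothesis K_lip : loc_lip (fun a (_ : 'rV[R]_S) c => K a c).
Hypothesis g_lip : loc_lip (fun a m c => g c m a).
Variable a0 : A.

(** The index of the result pairs the first action with the index of [F], so uniformity over whole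
    action sequences builds up one step at a time. *)
Lemma loc_lip_Phi (I : Type) (F : I -> 'rV[R]_S -> 'rV[R]_d -> R) :
  loc_lip F -> loc_lip (fun (p : A * I) m c =>
    F p.2 (Phi K g p.1 (m, c)).1 (Phi K g p.1 (m, c)).2).
Proof.
move=> lF B; have [Lk [Lk0 lk bk]] := K_lip B; have [Lg [Lg0 lg bg]] := g_lip B.
have [L [L0 lL bL]] := lF Lg.
(* [c] is the Lipschitz constant of the next measure, by m1 K1 - m2 K2 = (m1 - m2) K1 + m2 (K1 -
   K2). *)
pose c := S%:R * Lk; have c0 : 0 <= c by rewrite mulr_ge0.
(* The measure contributes [c] and the context [Lg * (c + 1)]; the leading 1 makes the constant also
   dominate the bound [L] on [F]. *)
exists (L * (1 + (c + Lg * (c + 1)))); split => [|[a i] m1 m2 c1 c2 /= m1S m2S c1B c2B|].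
- by rewrite mulr_ge0// !addr_ge0// mulr_ge0// addr_ge0.
- have S1 := simplex_mulmx (K_kernel a c1) m1S.
  have S2 := simplex_mulmx (K_kernel a c2) m2S.
  have dm : `|m1 *m K a c1 - m2 *m K a c2| <= c * (`|m1 - m2| + `|c1 - c2|).
    rewrite [X in `|X|](_ : _ = (m1 - m2) *m K a c1 + m2 *m (K a c1 - K a c2)).
      rewrite (le_trans (ler_normD _ _))// mulrDr lerD//.
        rewrite (le_trans (mulmx_norm_le _ _))// -mulrA ler_wpM2l// mulrC.
        by rewrite ler_wpM2r// (bk _ m1).
      rewrite (le_trans (mulmx_norm_le _ _))// -mulrA ler_wpM2l//.
      rewrite -[leRHS]mul1r ler_pM ?simplex_norm_le1//.
      by have := lk a m1 m1 c1 c2 m1S m1S c1B c2B; rewrite subrr normr0 add0r.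
    by rewrite mulmxBl mulmxBr addrA subrK.
  apply: le_trans (lL _ _ _ _ _ S1 S2 (bg _ _ _ S1 c1B) (bg _ _ _ S2 c2B)) _.
  rewrite -mulrA ler_wpM2l//.
  have dg := lg a _ _ _ _ S1 S2 c1B c2B.
  set D := `|m1 - m2| + _ in dm *.
  have D0 : 0 <= D by rewrite addr_ge0.
  rewrite mulrDl mul1r mulrDl ler_wpDl// lerD//.
  rewrite (le_trans dg)// -mulrA ler_wpM2l// mulrDl mul1r lerD//.
  by rewrite lerDr.
- move=> [a i] m c1 mS c1B /=; have S1 := simplex_mulmx (K_kernel a c1) mS.
  rewrite (le_trans (bL _ _ _ S1 (bg _ _ _ S1 c1B)))//.
  by rewrite ler_peMr// lerDl addr_ge0// mulr_ge0// addr_ge0.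
Qed.

Lemma Phis_tail (a : nat -> A) t z :
  Phis K g a t.+1 z = Phis K g (fun s => a s.+1) t (Phi K g (a 0%N) z).
Proof. by elim: t => //= t ->. Qed.

Lemma limit_valueS r T (a : nat -> A) m c :
  let z := Phi K g (a 0%N) (m, c) in
  limit_value K g r T.+1 a m c = r 1%N z.1 z.2 +
    limit_value K g (fun t => r t.+1) T (fun t => a t.+1) z.1 z.2.
Proof.
rewrite /limit_value big_add1 big_nat_recl//; congr (_ + _).
rewrite big_add1; apply: eq_bigr => t _.
by rewrite Phis_tail -surjective_pairing.
Qed.

Section limit_value.
Implicit Type r : nat -> 'rV[R]_S -> 'rV[R]_d -> R.

Definition lip_rewards r T :=
  forall t, (1 <= t <= T)%N -> loc_lip (fun _ : unit => r t).

Lemma lip_rewards_tail r T : lip_rewards r T.+1 ->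
  lip_rewards (fun t => r t.+1) T.
Proof. by move=> lr t /andP[_ tT]; exact: lr. Qed.

Lemma loc_lip_limit_value r T : lip_rewards r T ->
  loc_lip (fun a => limit_value K g r T a).
Proof.
elim: T r => [|T IH] r lr.
  have -> : (fun a => limit_value K g r 0 a) = (fun _ _ _ => 0).
    apply/funext => a; apply/funext => m; apply/funext => c.
    by rewrite /limit_value big_geq.
  exact: loc_lip0.
pose F a m c := r 1%N m c + limit_value K g (fun t => r t.+1) T a m c.
have lF : loc_lip F.
  apply: loc_lipD; last exact: IH (lip_rewards_tail lr).
  exact: (loc_lip_reindex (fun _ : nat -> A => tt) (lr 1%N isT)).
have := loc_lip_reindex (fun a : nat -> A => (a 0%N, fun t => a t.+1))
  (loc_lip_Phi lF).
congr loc_lip; apply/funext => a; apply/funext => m; apply/funext => c /=.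
by rewrite limit_valueS.
Qed.

Lemma loc_lip_limit_optimal_value r T : lip_rewards r T ->
  loc_lip (fun _ : unit => limit_optimal_value K g r T).
Proof.
by move=> lr; apply: (loc_lip_sup (fun=> a0)); exact: loc_lip_limit_value.
Qed.

Lemma limit_value_le_optimal r T a m c : lip_rewards r T -> simplex m ->
  limit_value K g r T a m c <= limit_optimal_value K g r T m c.
Proof.
move=> lr mS; have [L [_ _ bL]] := loc_lip_limit_value lr `|c|.
apply: (@le_sup_range _ _ (fun b => limit_value K g r T b m c) L) => b.
by rewrite (le_trans (ler_norm _))// bL.
Qed.

(** Prefixing [a] to a sequence for the remaining horizon yields a competitor for the full horizon;
    take the supremum over the continuations. *)
Lemma limit_optimal_valueS r T a m c : lip_rewards r T.+1 -> simplex m ->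
  let z := Phi K g a (m, c) in
  is_true (r 1%N z.1 z.2 +
    limit_optimal_value K g (fun t => r t.+1) T z.1 z.2 <=
    limit_optimal_value K g r T.+1 m c).
Proof.
move=> lr mS z; rewrite addrC -lerBrDr; apply: (sup_range_le (fun=> a0)) => b.
rewrite lerBrDr addrC.
have /= <- := limit_valueS r T (fun t => if t is s.+1 then b s else a) m c.
exact: limit_value_le_optimal.
Qed.

End limit_value.

End limit_dynamics.

Section jump.
Variables (R : realType) (S d : nat) (A : Type) (K : A -> 'rV[R]_d -> 'M[R]_S).

Definition jump N (a : A) (C : 'rV[R]_d) (x y : config N S) : R :=
  \prod_n K a C (x n) (y n).

Hypothesis K_kernel : forall a C, transition_kernel (K a C).

Lemma jump_ge0 N a C (x y : config N S) : 0 <= jump a C x y.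
Proof. by apply: prodr_ge0 => n _; exact: (K_kernel a C).1. Qed.

Lemma sum_jump N a C (x : config N S) : \sum_y jump a C x y = 1.
Proof. exact: sum_prod_kernel. Qed.

Lemma sum_jumpZ N a C (x : config N S) c : \sum_y jump a C x y * c = c.
Proof. by rewrite -mulr_suml sum_jump mul1r. Qed.

End jump.

Section particle_estimates.
Variables (R : realType) (S d : nat) (A : Type).
Variable K : A -> 'rV[R]_d -> 'M[R]_S.
Variable g : 'rV[R]_d -> 'rV[R]_S -> A -> 'rV[R]_d.
Hypothesis K_kernel : forall a C, transition_kernel (K a C).
Hypothesis K_lip : loc_lip (fun a (_ : 'rV[R]_S) c => K a c).
Hypothesis g_lip : loc_lip (fun a m c => g c m a).
Variable a0 : A.
Local Notation Q N := (@jump R S d A K N).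

(** Both systems start from the same context and use the same action, so they differ only through
    the next measure, which also enters the context via [g]. That [gamma] does not depend on the
    action or on [x] is what later allows arbitrary policies. *)
Lemma jump_limit_dist (I : Type) (F : I -> 'rV[R]_S -> 'rV[R]_d -> R) :
  loc_lip F -> forall B : R, exists2 gamma : R, 0 <= gamma &
  forall N i a (x : config N S) C, (0 < N)%N -> `|C| <= B ->
  let z := Phi K g a (empirical R x, C) in
  is_true (
    `|\sum_y Q N a C x y * F i (empirical R y) (g C (empirical R y) a) -
      F i z.1 z.2| <= gamma / Num.sqrt N%:R).
Proof.
move=> lF B; have [Lg [Lg0 lg bg]] := g_lip B; have [L [L0 lL _]] := lF Lg.
exists (L * (1 + Lg) * S%:R) => [|N i a x C N0 CB z].
  by rewrite !mulr_ge0// addr_ge0.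
have zS : simplex z.1 by apply: simplex_mulmx => //; exact: simplex_empirical.
rewrite -[F i z.1 z.2](sum_jumpZ K_kernel a C x) -sumrB.
rewrite (le_trans (ler_norm_sum _ _ _))//.
apply: (@le_trans _ _ (\sum_y Q N a C x y *
    (L * (1 + Lg) * `|empirical R y - empirical R x *m K a C|))).
  apply: ler_sum => y _; have yS := simplex_empirical R N0 y.
  rewrite -mulrBr normrM ger0_norm ?jump_ge0// ler_wpM2l ?jump_ge0//.
  apply: le_trans (lL _ _ _ _ _ yS zS (bg _ _ _ yS CB) (bg _ _ _ zS CB)) _.
  rewrite -mulrA ler_wpM2l// mulrDl mul1r lerD2l//.
  by have := lg a _ _ _ _ yS zS CB CB; rewrite subrr normr0 addr0.
under eq_bigr do rewrite mulrCA.
rewrite -mulr_sumr -[leRHS]mulrA ler_wpM2l ?mulr_ge0 ?addr_ge0//.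
exact: expected_deviation.
Qed.

Lemma config_value_fixed_limit r T : lip_rewards r T ->
  forall B : R, exists2 gamma : R, 0 <= gamma &
  forall N (a : nat -> A) (x : config N S) C, (0 < N)%N -> `|C| <= B ->
  `|config_value g r T (Q N) (fun t _ _ => a t) x C -
    limit_value K g r T a (empirical R x) C| <= gamma / Num.sqrt N%:R.
Proof.
elim: T r => [|T IH] r lr B.
  exists 0 => // N a x C _ _.
  by rewrite config_value0 /limit_value big_geq// subrr normr0 mul0r.
have [Lg [_ _ bg]] := g_lip B.
have [gam gam0 gamP] := IH _ (lip_rewards_tail lr) Lg.
pose F a m c := r 1%N m c + limit_value K g (fun t => r t.+1) T a m c.
have lF : loc_lip F.
  apply: loc_lipD; last exact: loc_lip_limit_value (lip_rewards_tail lr).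
  exact: (loc_lip_reindex (fun _ : nat -> A => tt) (lr 1%N isT)).
have [gam' gam'0 gam'P] := jump_limit_dist lF B.
(* [gam'] accounts for the first jump, with limit values as continuation; [gam] for replacing these
   by the particle values, whose contexts lie in the ball of radius [Lg]. *)
exists (gam' + gam) => [|N a x C N0 CB]; first exact: addr_ge0.
rewrite config_valueS; last by move=> *; exact: sum_jump.
rewrite limit_valueS mulrDl.
set s := \sum_y _; set z := Phi K g _ _.
have := gam'P N (fun t => a t.+1) (a 0%N) x C N0 CB.
rewrite -/z /=; set s' := \sum_y _ => s'z.
have -> : s - (r 1%N z.1 z.2 +
    limit_value K g (fun t => r t.+1) T (fun t => a t.+1) z.1 z.2) =
  (s' - F (fun t => a t.+1) z.1 z.2) + (s - s') by rewrite /F; ring.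
rewrite (le_trans (ler_normD _ _))// lerD//.
rewrite /s /s' -sumrB (le_trans (ler_norm_sum _ _ _))//.
rewrite -[leRHS](sum_jumpZ K_kernel (a 0%N) C x).
apply: ler_sum => y _; have yS := simplex_empirical R N0 y.
rewrite -mulrBr normrM ger0_norm ?jump_ge0// ler_wpM2l ?jump_ge0//.
rewrite /F opprD addrACA subrr add0r; apply: gamP => //.
exact: bg.
Qed.

(** From a given state any policy plays one definite first action, and its continuation is bounded
    by induction by the limit optimum from the next state; the limit Bellman inequality then absorbs
    that first action. *)
Lemma config_value_le_limit r T : lip_rewards r T ->
  forall B : R, exists2 gamma : R, 0 <= gamma &
  forall N (Pi : policy R S d A) (x : config N S) C, (0 < N)%N -> `|C| <= B ->
  config_value g r T (Q N) Pi x C <=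
    limit_optimal_value K g r T (empirical R x) C + gamma / Num.sqrt N%:R.
Proof.
elim: T r => [|T IH] r lr B.
  exists 0 => // N Pi x C N0 _; rewrite config_value0 mul0r addr0.
  rewrite (le_trans _ (limit_value_le_optimal K_kernel K_lip g_lip (fun=> a0) _ lr _))//.
    by rewrite /limit_value big_geq.
  exact: simplex_empirical.
have [Lg [_ _ bg]] := g_lip B.
have [gam gam0 gamP] := IH _ (lip_rewards_tail lr) Lg.
pose F (_ : unit) m c := r 1%N m c + limit_optimal_value K g (fun t => r t.+1) T m c.
have lF : loc_lip F.
  apply: loc_lipD; first exact: lr.
  exact: loc_lip_limit_optimal_value (lip_rewards_tail lr).
have [gam' gam'0 gam'P] := jump_limit_dist lF B.
exists (gam' + gam) => [|N Pi x C N0 CB]; first exact: addr_ge0.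
rewrite config_valueS; last by move=> *; exact: sum_jump.
set a := Pi 0%N _ _.
have := limit_optimal_valueS K_kernel K_lip g_lip a0 a C lr (simplex_empirical R N0 x).
set z := Phi K g _ _ => /= zle.
have := gam'P N tt a x C N0 CB.
rewrite -/z /= ler_distl => /andP[_ sle].
rewrite mulrDl addrA; 
apply: (@le_trans _ _ (F tt z.1 z.2 + gam' / Num.sqrt N%:R +
    gam / Num.sqrt N%:R)); last first.
  by rewrite !lerD2r.
apply: le_trans (lerD sle (lexx _)).
rewrite -[X in _ <= _ + X](sum_jumpZ K_kernel a C x) -big_split/=.
apply: ler_sum => y _; have yS := simplex_empirical R N0 y.
rewrite -mulrDr ler_wpM2l ?jump_ge0// /F -addrA lerD2l.
by apply: gamP => //; exact: bg.
Qed.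

End particle_estimates.

(** * Dynamic programming and continuity in the context *)

Lemma prod_dist_le (R : realType) (I : finType) (p q : I -> R) :
  (forall i, `|p i| <= 1) -> (forall i, `|q i| <= 1) ->
  `|\prod_i p i - \prod_i q i| <= \sum_i `|p i - q i|.
Proof.
move=> p1 q1.
(* The telescoping induction needs both partial products to stay bounded by 1. *)
suff [] : [/\ `|\prod_i p i| <= 1, `|\prod_i q i| <= 1 &
  `|\prod_i p i - \prod_i q i| <= \sum_i `|p i - q i|] by [].
elim/big_rec3: _ => [|i s x y _ [y1 x1 xys]]; first by rewrite subrr normr1 normr0.
split; rewrite ?normrM ?mulr_ile1//.
have -> : p i * y - q i * x = (p i - q i) * y + q i * (y - x) by ring.
rewrite (le_trans (ler_normD _ _))// !normrM lerD//; first by rewrite ler_piMr.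
by rewrite (le_trans _ xys)// ler_piMl.
Qed.

(** Put N m(i) particles in each state i, listed one state after the other. *)
Lemma empirical_surj (R : realType) (S N : nat) (m : 'rV[R]_S) :
  (0 < N)%N -> simplexN N m -> exists x : config N S, m = empirical R x.
Proof.
move=> N0 [[_ m1] mN]; have {mN}/choice[k kP] := mN.
have sumk : (\sum_i k i = N)%N.
  apply/eqP; rewrite -(eqr_nat R) natr_sum.
  by under eq_bigr do rewrite -kP; rewrite -mulr_sumr m1 mulr1.
pose s := flatten [seq nseq (k i) i | i <- enum 'I_S].
have sizes : size s = N.
  rewrite size_flatten /shape -map_comp sumnE big_map big_enum -[RHS]sumk/=.
  by apply: eq_bigr => i _; rewrite /= size_nseq.
have [i0 _] : exists i0 : 'I_S, True.
  case: s sizes => [/= n0|i ? _]; first by rewrite -n0 in N0.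
  by exists i.
pose x : config N S := [ffun n : 'I_N => nth i0 s n].
exists x; apply/rowP => i; rewrite mxE.
have -> : \sum_(n < N) (x n == i)%:R = (count_mem i s)%:R :> R.
  rewrite -sumn_count sumnE big_map natr_sum (big_nth i0) sizes big_mkord.
  by apply: eq_bigr => n _; rewrite ffunE.
have -> : count_mem i s = k i.
  rewrite count_flatten sumnE big_map big_map big_enum/=.
  rewrite (bigD1 i)//= count_nseq /= eqxx mul1n big1 ?addn0// => j ji.
  by rewrite count_nseq /= (negbTE ji).
by rewrite -kP mulKf// pnatr_eq0 -lt0n.
Qed.

Section ctx_lip.
Variables (R : realType) (d : nat).

(** Regularity in the context alone: [value] is 0 off the empirical measures, so the measure enters
    through a configuration in the index. The constants may depend on [N], since this notion serves
    measurability and not rates. *)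
Definition ctx_lip (I : Type) (F : I -> 'rV[R]_d -> R) :=
  forall B : R, exists L : R, [/\ 0 <= L,
    forall i c1 c2, `|c1| <= B -> `|c2| <= B ->
      `|F i c1 - F i c2| <= L * `|c1 - c2| &
    forall i c, `|c| <= B -> `|F i c| <= L].

Lemma ctx_lip_reindex (I J : Type) (h : J -> I) (F : I -> 'rV[R]_d -> R) :
  ctx_lip F -> ctx_lip (F \o h).
Proof. by move=> lF B; have [L [L0 lL bL]] := lF B; exists L; split => // i; eauto. Qed.

Lemma ctx_lip0 (I : Type) : ctx_lip (fun (_ : I) _ => 0).
Proof.
by move=> B; exists 0; split => // *; rewrite ?subrr ?mul0r normr0.
Qed.

Lemma ctx_lipD (I : Type) (F G : I -> 'rV[R]_d -> R) :
  ctx_lip F -> ctx_lip G -> ctx_lip (fun i c => F i c + G i c).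
Proof.
move=> lF lG B; have [L [L0 lL bL]] := lF B; have [M [M0 lM bM]] := lG B.
exists (L + M); split => [|i c1 c2 *|i c *]; first exact: addr_ge0.
  by rewrite opprD addrACA mulrDl (le_trans (ler_normD _ _))// lerD ?lL ?lM.
by rewrite (le_trans (ler_normD _ _))// lerD ?bL ?bM.
Qed.

Lemma ctx_lip_sup (I J : Type) (i0 : I) (F : I * J -> 'rV[R]_d -> R) :
  ctx_lip F -> ctx_lip (fun j c => sup [set F (i, j) c | i in setT]).
Proof.
move=> lF B; have [L [L0 lL bL]] := lF B; exists L; split => // [j|j].
  move=> c1 c2 c1B c2B.
  by apply: (@sup_range_dist _ _ i0 _ _ L) => i; [exact: bL|exact: bL|exact: lL].
by move=> c cB; apply: (sup_range_norm i0) => i; exact: bL.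
Qed.

Lemma ctx_lip_continuous (I : Type) (F : I -> 'rV[R]_d -> R) i :
  ctx_lip F -> continuous (F i).
Proof.
move=> lF; apply: locally_lipschitz_continuous => c.
have [L [L0 lL _]] := lF (`|c| + 1); exists L => // c' cc'.
apply: lL; first by rewrite lerDl.
rewrite -[c'](subrK c) addrC (le_trans (ler_normD _ _))// lerD2l.
by rewrite distrC ltW.
Qed.

End ctx_lip.

Section dynamic_programming.
Variables (R : realType) (S d : nat) (A : Type).
Variable K : A -> 'rV[R]_d -> 'M[R]_S.
Variable g : 'rV[R]_d -> 'rV[R]_S -> A -> 'rV[R]_d.
Hypothesis K_kernel : forall a C, transition_kernel (K a C).
Hypothesis K_lip : loc_lip (fun a (_ : 'rV[R]_S) c => K a c).
Hypothesis g_lip : loc_lip (fun a m c => g c m a).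
Variables (a0 : A) (N : nat).
Hypothesis N_gt0 : (0 < N)%N.
Local Notation Q := (@jump R S d A K N).
Implicit Type r : nat -> 'rV[R]_S -> 'rV[R]_d -> R.

Lemma jump_dist B : exists2 L : R, 0 <= L & forall a x y C1 C2,
  `|C1| <= B -> `|C2| <= B -> `|Q a C1 x y - Q a C2 x y| <= L * `|C1 - C2|.
Proof.
have [L [L0 lL bL]] := K_lip B; exists (N%:R * L) => [|a x y C1 C2 C1B C2B].
  exact: mulr_ge0.
have K1 C n : `|K a C (x n) (y n)| <= 1.
  by rewrite ger0_norm ?(kernel_le1 (K_kernel a C))//; exact: (K_kernel a C).1.
rewrite (le_trans (prod_dist_le (K1 _) (K1 _)))//.
rewrite -mulrA mulr_natl -[X in _ *+ X]card_ord -sumr_const.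
apply: ler_sum => n _; have xS := simplex_empirical R N_gt0 x.
have := lL a _ _ C1 C2 xS xS C1B C2B; rewrite subrr normr0 add0r.
by apply: le_trans; have := mx_entry_le (K a C1 - K a C2) (x n) (y n); rewrite !mxE.
Qed.

Lemma ctx_lip_jump (I : Type) (F : I -> 'rV[R]_S -> 'rV[R]_d -> R) :
  ctx_lip (fun (p : I * config N S) c => F p.1 (empirical R p.2) c) ->
  ctx_lip (fun (p : A * (I * config N S)) C => \sum_y Q p.1 C p.2.2 y *
    F p.2.1 (empirical R y) (g C (empirical R y) p.1)).
Proof.
move=> lF B; have [Lg [Lg0 lg bg]] := g_lip B; have [L [L0 lL bL]] := lF Lg.
have [Lq Lq0 lq] := jump_dist B.
(* The first term pays for the change of the transition probabilities, summed over all targets; the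
   second for the change of the payoff, averaged over the jump. *)
exists (#|config N S|%:R * (Lq * L) + L * (1 + Lg)); split.
- by rewrite addr_ge0 ?mulr_ge0 ?addr_ge0.
- move=> [a [i x]] C1 C2 /= C1B C2B; rewrite -sumrB.
  rewrite (le_trans (ler_norm_sum _ _ _))// mulrDl.
  rewrite -[X in _ <= _ + X](sum_jumpZ K_kernel a C2 x).
  rewrite -[X in _ <= X + _]mulrA mulr_natl -sumr_const -big_split/=.
  apply: ler_sum => y _; have yS := simplex_empirical R N_gt0 y.
  set u := F i _ _; set v := F i _ _.
  have -> : Q a C1 x y * u - Q a C2 x y * v =
    (Q a C1 x y - Q a C2 x y) * u + Q a C2 x y * (u - v) by ring.
  rewrite (le_trans (ler_normD _ _))// !normrM lerD//.
    rewrite mulrAC ler_pM ?lq//.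
    exact: (bL (i, y) _ (bg _ _ _ yS C1B)).
  rewrite ger0_norm ?jump_ge0// ler_wpM2l ?jump_ge0//.
  have := lL (i, y) _ _ (bg a _ _ yS C1B) (bg a _ _ yS C2B).
  move/le_trans; apply; rewrite -mulrA ler_wpM2l//.
  have := lg a _ _ _ _ yS yS C1B C2B; rewrite subrr normr0 add0r.
  by move/le_trans; apply; rewrite ler_wpM2r// lerDr.
- move=> [a [i x]] C /= CB; rewrite (le_trans (ler_norm_sum _ _ _))//.
  rewrite (@le_trans _ _ L)//; last first.
    rewrite (@le_trans _ _ (L * (1 + Lg)))//; first by rewrite ler_peMr// lerDl.
    by rewrite lerDr !mulr_ge0.
  rewrite -[leRHS](sum_jumpZ K_kernel a C x); apply: ler_sum => y _.
  have yS := simplex_empirical R N_gt0 y.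
  rewrite normrM ger0_norm ?jump_ge0// ler_wpM2l ?jump_ge0//.
  exact: (bL (i, y) _ (bg _ _ _ yS CB)).
Qed.

Lemma loc_lip_ctx_lip (I : Type) (F : 'rV[R]_S -> 'rV[R]_d -> R) :
  loc_lip (fun _ : unit => F) ->
  ctx_lip (fun (p : I * config N S) c => F (empirical R p.2) c).
Proof.
move=> lF B; have [L [L0 lL bL]] := lF B; exists L.
have xS := simplex_empirical R N_gt0.
split => // [[i x] c1 c2|[i x] c] /= *; last exact: bL.
by have := lL tt (empirical R x) (empirical R x) c1 c2; rewrite subrr normr0 add0r; exact.
Qed.

(** Each stage is a one-step problem whose reward includes the continuation. Writing it with
    [action_value] makes it a function of the measure, as policies are, and not of a
    configuration. *)
Fixpoint bellman T r (M : 'rV[R]_S) (C : 'rV[R]_d) : R :=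
  if T is U.+1 then
    sup [set action_value g
      (fun _ M' C' => r 1%N M' C' + bellman U (fun t => r t.+1) M' C')
      1 Q (fun=> a) M C | a in [set: A]]
  else 0.

Lemma sum_jump1 a C (x : config N S) : \sum_y Q a C x y = 1.
Proof. exact: sum_jump. Qed.

Lemma action_value1 r (a : A) (x : config N S) C :
  action_value g r 1 Q (fun=> a) (empirical R x) C =
  \sum_y Q a C x y * r 1%N (empirical R y) (g C (empirical R y) a).
Proof.
rewrite /action_value (value_empirical (K := K))//.
rewrite (config_valueS _ sum_jump1).
by apply: eq_bigr => y _; rewrite config_value0 addr0.
Qed.

Lemma bellmanS T r (x : config N S) C :
  bellman T.+1 r (empirical R x) C = sup [set \sum_y Q a C x y *
     (r 1%N (empirical R y) (g C (empirical R y) a) +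
      bellman T (fun t => r t.+1) (empirical R y) (g C (empirical R y) a))
    | a in [set: A]].
Proof.
by rewrite /=; congr (sup (image _ _)); apply/funext => a; rewrite action_value1.
Qed.

Lemma ctx_lip_bellman T r : lip_rewards r T ->
  ctx_lip (fun (p : unit * config N S) C => bellman T r (empirical R p.2) C).
Proof.
elim: T r => [|T IH] r lr; first exact: ctx_lip0.
have := ctx_lip_sup a0 (ctx_lip_jump (F := fun _ m c => r 1%N m c +
    bellman T (fun t => r t.+1) m c)
  (ctx_lipD (loc_lip_ctx_lip unit (lr 1%N isT)) (IH _ (lip_rewards_tail lr)))).
congr ctx_lip; apply/funext => -[u x]; apply/funext => C.
by rewrite bellmanS.
Qed.

Lemma ctx_lip_config_value T r : lip_rewards r T -> forall a : nat -> A,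
  ctx_lip (fun (p : unit * config N S) C =>
    config_value g r T Q (fun t _ _ => a t) p.2 C).
Proof.
elim: T r => [|T IH] r lr a.
  have := @ctx_lip0 R d (unit * config N S).
  congr ctx_lip; apply/funext => p; apply/funext => C.
  by rewrite config_value0.
pose a' t := a t.+1; pose r' t := r t.+1.
pose F (_ : unit) (m : 'rV[R]_S) C :=
  r 1%N m C + action_value g r' T Q a' m C.
have lF : ctx_lip (fun (p : unit * config N S) c => F p.1 (empirical R p.2) c).
  apply: ctx_lipD; first exact: loc_lip_ctx_lip (lr 1%N isT).
  have := IH _ (lip_rewards_tail lr) a'.
  congr ctx_lip; apply/funext => p; apply/funext => C.
  by rewrite /action_value (value_empirical (K := K)).
have := ctx_lip_reindex (fun p : unit * config N S => (a 0%N, p)) (ctx_lip_jump lF).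
congr ctx_lip; apply/funext => p; apply/funext => C /=.
rewrite (config_valueS _ sum_jump1); apply: eq_bigr => y _.
by rewrite /F /action_value (value_empirical (K := K)).
Qed.

Lemma config_value_le_bellman T r Pi (x : config N S) C : lip_rewards r T ->
  config_value g r T Q Pi x C <= bellman T r (empirical R x) C.
Proof.
elim: T r Pi x C => [|T IH] r Pi x C lr; first by rewrite config_value0.
rewrite (config_valueS _ sum_jump1) bellmanS.
have lr' := lip_rewards_tail lr.
set a := Pi 0%N _ _.
pose H a := \sum_y Q a C x y *
     (r 1%N (empirical R y) (g C (empirical R y) a) +
      bellman T (fun t => r t.+1) (empirical R y) (g C (empirical R y) a)).
have [L HL] : exists L, forall a, H a <= L.
  have := ctx_lip_jump (F := fun _ m c => r 1%N m c +
      bellman T (fun t => r t.+1) m c)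
    (ctx_lipD (loc_lip_ctx_lip unit (lr 1%N isT)) (ctx_lip_bellman lr')).
  move=> /(_ `|C|)[L [_ _ bL]]; exists L => b.
  by rewrite (le_trans (ler_norm _))//; exact: (bL (b, (tt, x))).
apply: le_trans (le_sup_range a HL).
by apply: ler_sum => y _; rewrite ler_wpM2l ?jump_ge0// lerD2l IH.
Qed.

(** The suprema need not be attained, so half of [e] is lost on the first action and half on the
    rest. A single policy must serve all [x] and [C], because the state after a jump is random;
    policies being arbitrary maps, it can be assembled by choice. *)
Lemma config_value_ge_bellman T r e : lip_rewards r T -> 0 < e ->
  exists Pi, forall (x : config N S) C,
    bellman T r (empirical R x) C - e <= config_value g r T Q Pi x C.
Proof.
elim: T r e => [|T IH] r e lr e0.
  by exists (fun _ _ _ => a0) => x C; rewrite config_value0 sub0r oppr_le0 ltW.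
have lr' := lip_rewards_tail lr.
have e20 : 0 < e / 2 by rewrite divr_gt0.
have [Pi PiP] := IH _ _ lr' e20.
pose H (p : 'rV[R]_S * 'rV[R]_d) a := action_value g
  (fun _ M' C' => r 1%N M' C' + bellman T (fun t => r t.+1) M' C')
  1 Q (fun=> a) p.1 p.2.
have HE x C a : H (empirical R x, C) a = \sum_y Q a C x y *
     (r 1%N (empirical R y) (g C (empirical R y) a) +
      bellman T (fun t => r t.+1) (empirical R y) (g C (empirical R y) a)).
  by rewrite /H action_value1.
(* The condition on [p.1] lets [choice] range over all pairs; off the empirical measures the action
   defaults to [a0]. *)
have fe (p : 'rV[R]_S * 'rV[R]_d) :
    exists a, forall x : config N S, empirical R x = p.1 ->
    bellman T.+1 r p.1 p.2 - e / 2 < H p a.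
  case: p => M C.
  have [[x xM]|nM] := pselect (exists x : config N S, empirical R x = M);
    last first.
    by exists a0 => x xM; exfalso; apply: nM; exists x.
  have [L HL] : exists L, forall a, H (M, C) a <= L.
    have := ctx_lip_jump (F := fun _ m c => r 1%N m c +
        bellman T (fun t => r t.+1) m c)
      (ctx_lipD (loc_lip_ctx_lip unit (lr 1%N isT)) (ctx_lip_bellman lr')).
    move=> /(_ `|C|)[L [_ _ bL]]; exists L => b.
    by rewrite -xM HE (le_trans (ler_norm _))//; exact: (bL (b, (tt, x))).
  by have [a aP] := sup_range_adherent a0 HL e20; exists a.
have [f fP] := choice fe.
exists (fun t M C => if t is s.+1 then Pi s M C else f (M, C)) => x C.
rewrite (config_valueS _ sum_jump1)/=; set a := f _.
have := fP (empirical R x, C) x erefl; rewrite -/a HE /= => /ltW Ha.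
rewrite [X in _ - X]splitr opprD addrA -lerBrDr opprK.
rewrite (le_trans Ha)// -[X in _ <= _ + X](sum_jumpZ K_kernel a C x) -big_split/=.
apply: ler_sum => y _; rewrite -mulrDr ler_wpM2l ?jump_ge0// -addrA lerD2l.
by rewrite -lerBlDr; exact: PiP.
Qed.

Lemma optimal_value_bellman T r (x : config N S) C : lip_rewards r T ->
  optimal_value g r T Q (empirical R x) C = bellman T r (empirical R x) C.
Proof.
move=> lr; rewrite /optimal_value.
have vE Pi : value g r T Q Pi (empirical R x) C = config_value g r T Q Pi x C.
  exact: (value_empirical (K := K)).
have le_b Pi : value g r T Q Pi (empirical R x) C <= bellman T r (empirical R x) C.
  by rewrite vE config_value_le_bellman.
apply/eqP; rewrite eq_le; apply/andP; split.
  exact: (sup_range_le (fun _ _ _ => a0)).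
apply/ler_addgt0Pr => e e0; have [Pi PiP] := config_value_ge_bellman lr e0.
rewrite -lerBlDr (le_trans (PiP x C))// -vE.
exact: le_sup_range le_b.
Qed.

Lemma value_le_optimal T r Pi (x : config N S) C : lip_rewards r T ->
  config_value g r T Q Pi x C <= optimal_value g r T Q (empirical R x) C.
Proof. by move=> lr; rewrite optimal_value_bellman// config_value_le_bellman. Qed.

Lemma continuous_optimal_value T r (x : config N S) : lip_rewards r T ->
  continuous (optimal_value g r T Q (empirical R x)).
Proof.
move=> lr; have -> : optimal_value g r T Q (empirical R x) =
    bellman T r (empirical R x).
  by apply/funext => C; exact: optimal_value_bellman.
exact: (@ctx_lip_continuous _ _ _ _ (tt, x) (ctx_lip_bellman lr)).
Qed.

Lemma continuous_action_value T r a (x : config N S) : lip_rewards r T ->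
  continuous (action_value g r T Q a (empirical R x)).
Proof.
move=> lr; have -> : action_value g r T Q a (empirical R x) =
    config_value g r T Q (fun t _ _ => a t) x.
  by apply/funext => C; exact: (value_empirical (K := K)).
exact: (@ctx_lip_continuous _ _ _ _ (tt, x) (ctx_lip_config_value lr a)).
Qed.

End dynamic_programming.

(** * Uniform Lipschitz bounds from continuous differentiability *)

Section compact_sets.
Variables (R : realType) (S d : nat).

Lemma compact_norm_le n (B : R) : compact [set c : 'rV[R]_n | `|c| <= B].
Proof.
apply: bounded_closed_compact.
  exists B; split; first exact: num_real.
  by move=> M BM c /= cB; rewrite (le_trans cB)// ltW.
apply: (@preimage_closed _ _ (fun c : 'rV[R]_n => `|c|) [set x | x <= B]).
  by move=> c _; exact: norm_continuous.
exact: closed_le.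
Qed.

Lemma compact_simplex : compact (@simplex R S).
Proof.
apply: bounded_closed_compact.
  exists 1; split; first exact: num_real.
  by move=> M M1 m /= /simplex_norm_le1 /le_trans; apply; exact: ltW.
have -> : @simplex R S = \bigcap_i [set m : 'rV[R]_S | 0 <= m ord0 i] `&`
    [set m | \sum_i m ord0 i = 1].
  by apply/seteqP; split => m [m0 m1]; split => // i; [move=> _|]; exact: m0.
apply: closedI.
  apply: closed_bigI => i _.
  apply: (@preimage_closed _ _ (fun m : 'rV[R]_S => m ord0 i) [set x | 0 <= x]).
    by move=> m _; exact: coord_continuous.
  exact: closed_ge.
apply: (@preimage_closed _ _ (fun m : 'rV[R]_S => \sum_i m ord0 i) [set 1]).
  move=> m _; apply: locally_lipschitz_continuous => {}m.
  exists S%:R => // m' _; rewrite -sumrB (le_trans (ler_norm_sum _ _ _))//.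
  have -> : S%:R * `|m - m'| = \sum_(i < S) `|m - m'|.
    by rewrite sumr_const card_ord mulr_natl.
  by apply: ler_sum => i _; have := mx_entry_le (m - m') ord0 i; rewrite !mxE.
exact: closed_eq.
Qed.

(** Measure and context are joined into one row vector, the form of argument that [C1_on] and
    [C1_on_param] expect. *)
Definition box (B : R) : set 'rV[R]_(S + d) :=
  [set z | simplex (lsubmx z) /\ `|rsubmx z| <= B].

Lemma compact_box B : compact (box B).
Proof.
pose h (p : 'rV[R]_S * 'rV[R]_d) : 'rV[R]_(S + d) := row_mx p.1 p.2.
have -> : box B = h @` (@simplex R S `*` [set c : 'rV[R]_d | `|c| <= B]).
  apply/seteqP; split => [z [zS zB]|_ [[m c] [mS cB] <-]].
    by exists (lsubmx z, rsubmx z); rewrite /h/= ?hsubmxK.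
  by rewrite /box /h /= row_mxKl row_mxKr.
apply: continuous_compact.
  apply: continuous_subspaceT; apply: locally_lipschitz_continuous => -[m c].
  exists 1 => // -[m' c'] _; rewrite mul1r /h /= opp_row_mx add_row_mx.
  by apply: row_mx_norm_le; rewrite [leRHS]/Num.norm /= le_max lexx ?orbT.
apply: compact_setX; first exact: compact_simplex.
exact: compact_norm_le.
Qed.

Lemma convex_norm_le (V : normedModType R) (x y : V) (s B : R) :
  `|x| <= B -> `|y| <= B -> 0 <= s <= 1 -> `|x + s *: (y - x)| <= B.
Proof.
move=> xB yB /andP[s0 s1].
have -> : x + s *: (y - x) = (1 - s) *: x + s *: y.
  by rewrite scalerBr scalerBl scale1r addrA addrAC.
rewrite (le_trans (ler_normD _ _))// !normrZ !ger0_norm ?subr_ge0//.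
have -> : B = (1 - s) * B + s * B by ring.
by rewrite lerD// ler_wpM2l// subr_ge0.
Qed.

Lemma convex_simplex (x y : 'rV[R]_S) (s : R) :
  simplex x -> simplex y -> 0 <= s <= 1 -> simplex (x + s *: (y - x)).
Proof.
move=> [x0 x1] [y0 y1] /andP[s0 s1]; split => [i|].
  rewrite !mxE; have := x0 i; have := y0 i; nra.
under eq_bigr do rewrite !mxE.
by rewrite big_split/= -mulr_sumr sumrB x1 y1 subrr mulr0 addr0.
Qed.

Lemma convex_box B x y (s : R) :
  box B x -> box B y -> 0 <= s <= 1 -> box B (x + s *: (y - x)).
Proof.
move=> [xS xB] [yS yB] s01; rewrite /box /= !(linearD, linearZ, linearN) /=.
by split; [exact: convex_simplex|exact: convex_norm_le].
Qed.

Lemma row_mx_dist_le (m1 m2 : 'rV[R]_S) (c1 c2 : 'rV[R]_d) :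
  `|row_mx m1 c1 - row_mx m2 c2| <= `|m1 - m2| + `|c1 - c2|.
Proof.
rewrite opp_row_mx add_row_mx; apply: row_mx_norm_le.
  by rewrite lerDl.
by rewrite lerDr.
Qed.

Lemma box_row_mx B (m : 'rV[R]_S) (c : 'rV[R]_d) :
  simplex m -> `|c| <= B -> box B (row_mx m c).
Proof. by rewrite /box /= row_mxKl row_mxKr. Qed.

End compact_sets.

Section loc_lip_of_C1.
Variables (R : realType) (S d : nat) (A : uniformType).
Hypothesis A_compact : compact [set: A].

Lemma loc_lip_kernel (K : A -> 'rV[R]_d -> 'M[R]_S) :
  (forall a C, transition_kernel (K a C)) ->
  (forall i j, C1_on_param setT (fun (C : 'rV[R]_d) (a : A) => K a C i j)) ->
  loc_lip (fun a (_ : 'rV[R]_S) c => K a c).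
Proof.
move=> K_kernel C1K B.
have /choice[L LP] : forall p : 'I_S * 'I_S, exists L : R, 0 <= L /\
    forall a c1 c2, `|c1| <= B -> `|c2| <= B ->
    `|K a c1 p.1 p.2 - K a c2 p.1 p.2| <= L * `|c1 - c2|.
  move=> [i j].
  have [L L0 lL] := C1_on_param_lipschitz
    (@subsetT _ [set c : 'rV[R]_d | `|c| <= B]) (@compact_norm_le R d B)
    (fun x y s xB yB s01 => convex_norm_le xB yB s01) A_compact (C1K i j).
  by exists L; split => // a c1 c2 c1B c2B; exact: lL.
have sL : 0 <= \sum_p L p by rewrite sumr_ge0// => p _; have [] := LP p.
(* The 1 bounds the entries of a kernel; the sum dominates the Lipschitz constant of each entry. *)
exists (1 + \sum_p L p); split => [|a m1 m2 c1 c2 _ _ c1B c2B|a _ c _ _].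
- exact: addr_ge0.
- rewrite mulrDr ler_wpDl ?mulr_ge0// ?addr_ge0//.
  apply: mx_norm_leP => [|i j]; first by rewrite mulr_ge0// addr_ge0.
  rewrite !mxE; have [_ /(_ a _ _ c1B c2B)/= /le_trans] := LP (i, j); apply.
  rewrite ler_wpM2r// ler_wpDl// (bigD1 (i, j))//= lerDl.
  by rewrite sumr_ge0// => p _; have [] := LP p.
- apply: mx_norm_leP => [|i j]; first exact: addr_ge0.
  rewrite ger0_norm ?(K_kernel a c).1//.
  by rewrite (le_trans (kernel_le1 (K_kernel a c) i j))// lerDl.
Qed.

Lemma loc_lip_context (g : 'rV[R]_d -> 'rV[R]_S -> A -> 'rV[R]_d) :
  {within [set z : 'rV[R]_d * 'rV[R]_S * A | simplex z.1.2],
     continuous (fun z : 'rV[R]_d * 'rV[R]_S * A => g z.1.1 z.1.2 z.2)} ->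
  (forall k, C1_on_param [set z : 'rV[R]_(S + d) | simplex (lsubmx z)]
     (fun (z : 'rV[R]_(S + d)) (a : A) => g (rsubmx z) (lsubmx z) a ord0 k)) ->
  loc_lip (fun a m c => g c m a).
Proof.
move=> cg C1g B.
have /choice[L LP] : forall k : 'I_d, exists L : R, 0 <= L /\
    forall a x y, box B x -> box B y ->
    `|g (rsubmx y) (lsubmx y) a ord0 k - g (rsubmx x) (lsubmx x) a ord0 k|
      <= L * `|y - x|.
  move=> k.
  have BD : @box R S d B `<=` [set z | simplex (lsubmx z)] by move=> z [].
  have [L L0 lL] := C1_on_param_lipschitz BD (@compact_box R S d B)
    (@convex_box R S d B) A_compact (C1g k).
  by exists L.
(* [M] bounds [g] itself, which confines the next context to a ball. *)
have [M M0 MP] := continuous_compact_bounded cg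
  (X := [set c : 'rV[R]_d | `|c| <= B] `*` @simplex R S `*` [set: A])
  (fun z zX => zX.1.2)
  (compact_setX (compact_setX (@compact_norm_le R d B) (@compact_simplex R S)) A_compact).
have sL : 0 <= \sum_p L p by rewrite sumr_ge0// => p _; have [] := LP p.
exists (M + \sum_p L p); split => [|a m1 m2 c1 c2 m1S m2S c1B c2B|a m c mS cB].
- by rewrite addr_ge0// ltW.
- apply: mx_norm_leP => [|i k]; first by rewrite mulr_ge0// addr_ge0// ltW.
  rewrite ord1 !mxE; have [L0 lL] := LP k.
  have := lL a _ _ (box_row_mx m2S c2B) (box_row_mx m1S c1B).
  rewrite !row_mxKl !row_mxKr => /le_trans; apply.
  rewrite ler_pM ?row_mx_dist_le// ler_wpDl ?(ltW M0)// (bigD1 k)//= lerDl.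
  by rewrite sumr_ge0// => p _; have [] := LP p.
- rewrite (le_trans (MP (c, m, a) _))//; by rewrite lerDl.
Qed.

Lemma loc_lip_reward (r : 'rV[R]_S -> 'rV[R]_d -> R) :
  {within [set z : 'rV[R]_S * 'rV[R]_d | simplex z.1],
     continuous (fun z : 'rV[R]_S * 'rV[R]_d => r z.1 z.2)} ->
  C1_on [set z : 'rV[R]_(S + d) | simplex (lsubmx z)]
    (fun z : 'rV[R]_(S + d) => r (lsubmx z) (rsubmx z)) ->
  loc_lip (fun _ : unit => r).
Proof.
move=> cr C1r B.
have BD : @box R S d B `<=` [set z | simplex (lsubmx z)] by move=> z [].
have [L L0 lL] := C1_on_lipschitz BD (@compact_box R S d B) (@convex_box R S d B) C1r.
have [M M0 MP] := continuous_compact_bounded cr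
  (X := @simplex R S `*` [set c : 'rV[R]_d | `|c| <= B]) (fun z zX => zX.1)
  (compact_setX (@compact_simplex R S) (@compact_norm_le R d B)).
exists (M + L); split => [|_ m1 m2 c1 c2 m1S m2S c1B c2B|_ m c mS cB].
- by rewrite addr_ge0// ltW.
- have := lL _ _ (box_row_mx m2S c2B) (box_row_mx m1S c1B).
  rewrite !row_mxKl !row_mxKr => /le_trans; apply.
  by rewrite ler_pM ?row_mx_dist_le// ler_wpDl ?(ltW M0).
- by rewrite (le_trans (MP (m, c) _))// lerDl.
Qed.

End loc_lip_of_C1.

(** * Measurability and limits in law *)

Section random_vector_measurability.
Variables (R : realType) (dO : measure_display) (Omega : measurableType dO).

(** [random_vector] only gives measurable coordinates. An open set is the countable union of the
    closed cubes inside it with rational centre and radius 1 / (k + 1), and membership in a cube is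
    a condition on coordinates. *)
Lemma measurable_preimage_open n (Z : Omega -> 'rV[R]_n) (O : set 'rV[R]_n) :
  random_vector Z -> open O -> measurable (Z @^-1` O).
Proof.
move=> mZ oO.
pose box (p : 'rV[rat]_n * nat) : set 'rV[R]_n :=
  [set y | forall i, `|y ord0 i - ratr (p.1 ord0 i)| <= p.2.+1%:R^-1].
pose F p := [set w | box p (Z w) /\ box p `<=` O].
have -> : Z @^-1` O = \bigcup_p F p.
  apply/seteqP; split => [w /= OZ|w [p _ [bp]]]; last exact.
  have /nbhs_ballP[e /= e0 eO] := open_nbhs_nbhs (conj oO OZ).
  (* Two points of one cube differ by at most twice its radius, so a cube containing [Z w] stays
     within the [e]-ball around it. *)
  have [k ke] : exists k : nat, 2 * k.+1%:R^-1 < e.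
    exists (Num.truncn (2 / e)); rewrite -ltr_pdivlMl// -[ltRHS]invrK.
    rewrite ltf_pV2 ?posrE ?invr_gt0 ?mulr_gt0 ?invr_gt0 ?ltr0n//.
    by rewrite invfM invrK mulrC truncnS_gt.
  have k0 : 0 < k.+1%:R^-1 :> R by rewrite invr_gt0 ltr0n.
  have /choice[q qP] : forall i : 'I_n, exists q : rat,
      ratr q \in `]Z w ord0 i - k.+1%:R^-1, Z w ord0 i + k.+1%:R^-1[.
    by move=> i; apply: rat_in_itvoo; rewrite ltrBlDr -addrA ltrDl addr_gt0.
  have qP' i : `|Z w ord0 i - ratr (q i)| <= k.+1%:R^-1.
    have := qP i; rewrite in_itv/= => /andP[q1 q2].
    by rewrite ler_distlC !ltW.
  exists (\row_i q i, k) => //; split => [i|y yb]; first by rewrite mxE.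
  apply: eO; rewrite -ball_normE /=; apply: le_lt_trans ke.
  apply: mx_norm_leP => [|i j]; first by rewrite mulr_ge0// ltW.
  rewrite ord1 !mxE; have := yb j; rewrite mxE /= => yj.
  have -> : Z w ord0 j - y ord0 j =
    (Z w ord0 j - ratr (q j)) - (y ord0 j - ratr (q j)) by ring.
  by rewrite (le_trans (ler_normB _ _))// mulr_natl mulr2n lerD.
apply: countable_bigcupT_measurable => // p.
have [pO|npO] := pselect (box p `<=` O); last first.
  by rewrite [F p](_ : _ = set0)//; apply/seteqP; split => w // [].
have -> : F p = \bigcap_(i in [set: 'I_n])
    [set w | `|Z w ord0 i - ratr (p.1 ord0 i)| <= p.2.+1%:R^-1].
  apply/seteqP; split => [w [bp _] i _|w bp]; first exact: bp.
  by split => // i; exact: bp.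
apply: fin_bigcap_measurable => // i _; rewrite -[X in measurable X]setTI.
apply: measurable_fun_le => //; apply: measurableT_comp => //.
exact: measurable_funB.
Qed.

Lemma measurable_continuous_comp n (Z : Omega -> 'rV[R]_n) (f : 'rV[R]_n -> R) :
  random_vector Z -> continuous f -> measurable_fun setT (fun w => f (Z w)).
Proof.
move=> mZ /continuousP cf; apply: (measurability _ (RGenOInfty.measurableE R)).
move=> _ [_ [x ->] <-]; rewrite setTI.
have -> : (fun w => f (Z w)) @^-1` `]x, +oo[ = Z @^-1` (f @^-1` `]x, +oo[) by [].
by apply: measurable_preimage_open => //; apply: cf; exact: interval_open.
Qed.

(** Splitting along the finitely many values of [X] requires of [F] no regularity in its first
    argument. *)
Lemma measurable_comp_finite (I : finType) n m (e : I -> 'rV[R]_n)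
    (F : 'rV[R]_n -> 'rV[R]_m -> R) (X : Omega -> 'rV[R]_n) (Y : Omega -> 'rV[R]_m) :
  random_vector X -> random_vector Y -> (forall w, exists i, X w = e i) ->
  (forall i, continuous (F (e i))) ->
  measurable_fun setT (fun w => F (X w) (Y w)).
Proof.
move=> mX mY Xe cF _ B mB; rewrite setTI.
have -> : (fun w => F (X w) (Y w)) @^-1` B =
    \bigcup_i ([set w | X w = e i] `&` (fun w => F (e i) (Y w)) @^-1` B).
  apply/seteqP; split => [w /= FB|w [i _ [/= -> //]]].
  by have [i Xi] := Xe w; exists i => //; split => //; rewrite /= -Xi.
apply: countable_bigcupT_measurable => // i; apply: measurableI; last first.
  by rewrite -[X in measurable X]setTI; exact: (measurable_continuous_comp mY (cF i)).
have -> : [set w | X w = e i] = setT `&` (fun w => `|X w - e i|) @^-1` [set 0].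
  rewrite setTI; apply/seteqP; split => w /= [].
    by move=> ->; rewrite subrr normr0.
  by move=> /eqP; rewrite normr_eq0 subr_eq0 => /eqP.
apply: (measurable_continuous_comp (f := fun z => `|z - e i|) mX) => //.
apply: locally_lipschitz_continuous => x; exists 1 => // y _.
rewrite mul1r (le_trans (ler_dist_dist _ _))//.
by rewrite opprB addrA subrK.
Qed.

Lemma random_vector_row_mx n m (X : Omega -> 'rV[R]_n) (Y : Omega -> 'rV[R]_m) :
  random_vector X -> random_vector Y ->
  random_vector (fun w => row_mx (X w) (Y w)).
Proof.
move=> mX mY i; rewrite -[i]splitK; case: (fintype.split i) => j /=.
  by under eq_fun do rewrite row_mxEl; exact: mX.
by under eq_fun do rewrite row_mxEr; exact: mY.
Qed.

Lemma random_vector_subr n (X : Omega -> 'rV[R]_n) b :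
  random_vector X -> random_vector (fun w => X w - b).
Proof.
move=> mX i; have -> : (fun w => (X w - b) ord0 i) =
    (fun w => X w ord0 i - b ord0 i) by apply/funext => w; rewrite !mxE.
exact: measurable_funB.
Qed.

End random_vector_measurability.

Section limsup_in_law.
Variables (R : realType) (dO dG : measure_display).
Variables (Omega : measurableType dO) (OmegaG : measurableType dG).
Variables (P : probability Omega R) (PG : probability OmegaG R).

(** An eventual comparison is the right form, as the particle system is controlled for positive [N]
    only. *)
Lemma limn_esup_le_eventually (u v : (\bar R)^nat) :
  (\forall n \near \oo, (u n <= v n)%E) -> (limn_esup u <= limn_esup v)%E.
Proof.
move=> uv; apply: le_ereal_inf_tmp; move=> _ [V Voo <-]; apply: ge_ereal_inf.
exists (ereal_sup (u @` (V `&` [set n | (u n <= v n)%E]))).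
  by exists (V `&` [set n | (u n <= v n)%E]) => //; exact: filterI.
apply: ge_ereal_sup => _ [n [Vn uvn] <-].
by apply: le_trans uvn _; apply: ereal_sup_ubound; exists n.
Qed.

Variables (n : nat) (Z : nat -> Omega -> 'rV[R]_n) (G : OmegaG -> 'rV[R]_n).
Hypothesis Z_rv : forall N, (0 < N)%N -> random_vector (Z N).
Hypothesis G_rv : random_vector G.
Hypothesis Z_law : cvg_in_law P PG Z G.

(** Portmanteau for the closed set where [h] is nonnegative. Convergence in law tests continuous
    functions, so the indicator is relaxed to one supported in [D k]; these sets decrease to the
    closed set as [k] grows. *)
Lemma limn_esup_prob_le (h : 'rV[R]_n -> R) (E : nat -> set Omega) :
  continuous h -> (forall N, (0 < N)%N -> measurable (E N)) ->
  (forall N, (0 < N)%N -> {ae P, forall w, E N w -> 0 <= h (Z N w)}) ->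
  (limn_esup (fun N => P (E N)) <= PG [set w | (0 <= h (G w))%R])%E.
Proof.
move=> ch mE Eh.
have mhG : measurable_fun setT (fun w => h (G w)) by exact: measurable_continuous_comp.
pose D k := [set w | - k.+1%:R^-1 <= h (G w)].
have mD k : measurable (D k).
  by rewrite -[D k]setTI; apply: measurable_fun_le.
have DE : \bigcap_k D k = [set w | 0 <= h (G w)].
  apply/seteqP; split => [w Dw|w /= hw k _]; last first.
    by rewrite /D /= (le_trans _ hw)// oppr_le0 invr_ge0.
  apply/ler_addgt0Pr => e e0; rewrite -lerBlDr sub0r.
  have ke : (Num.truncn e^-1).+1%:R^-1 <= e.
    by rewrite invf_ple ?posrE ?ltr0n// ltW// truncnS_gt.
  by rewrite (le_trans _ (Dw (Num.truncn e^-1) I))// lerN2.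
have cD : PG (D k) @[k --> \oo] --> PG [set w | 0 <= h (G w)].
  rewrite -DE; apply: nonincreasing_cvg_mu => //.
  - by rewrite (le_lt_trans (probability_le1 _ _))// ltry.
  - by rewrite DE -[X in measurable X]setTI; apply: measurable_fun_le.
  - move=> i j ij; apply/subsetPset => w; rewrite /D /= => /(le_trans _); apply.
    by rewrite lerN2 lef_pV2 ?posrE ?ltr0n// ler_nat.
apply: (cvge_ge _ cD); apply: nearW => k.
(* [f] is 1 where [h] is nonnegative, 0 where [h] is at most -1 / (k + 1), and affine in [h]
   between. *)
pose f z := Num.min 1 (Num.max 0 (1 + k.+1%:R * h z)).
have f0 z : 0 <= f z by rewrite le_min ler01 le_max lexx.
have f1 z : f z <= 1 by rewrite ge_min lexx.
have cl : continuous (fun z => 1 + k.+1%:R * h z).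
  move=> z; apply: (@continuousD _ R _ (fun=> 1) (fun z => k.+1%:R * h z)).
    exact: cst_continuous.
  by apply: (@continuousM R _ (fun=> k.+1%:R) h); [exact: cst_continuous|exact: ch].
have cf : continuous f.
  move=> z; apply: (@continuous_min _ _ (fun=> 1)
    (fun z => Num.max 0 (1 + k.+1%:R * h z))); first exact: cst_continuous.
  apply: (@continuous_max _ _ (fun=> 0) (fun z => 1 + k.+1%:R * h z)).
    exact: cst_continuous.
  exact: cl.
have /(Z_law cf) cvf : exists b : R, forall z, `|f z| <= b.
  by exists 1 => z; rewrite ger0_norm.
have mf d (T : measurableType d) (Y : T -> 'rV[R]_n) : random_vector Y ->
    measurable_fun setT (fun w => (f (Y w))%:E).
  by move=> mY; apply/measurable_EFinP; exact: measurable_continuous_comp.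
apply: (@le_trans _ _ (limn_esup (fun N => 'E_P[fun w => f (Z N w)])%E)).
  apply: limn_esup_le_eventually; exists 1%N => // N /= N0.
  rewrite unlock -[E N]setIT -integral_indic//; last exact: mE.
  apply: ae_ge0_le_integral => //.
  - by apply/measurable_EFinP; apply: measurable_indic; exact: mE.
  - by move=> w _; rewrite lee_fin.
  - by apply: mf; exact: Z_rv.
  apply: filterS (Eh N N0) => w Ew _; rewrite lee_fin indicE.
  have [wE|_] := boolP (w \in E N); last exact: f0.
  have {wE}/Ew hw : E N w by rewrite inE in wE.
  by rewrite /f le_min lexx/= le_max lerDl mulr_ge0 ?orbT.
rewrite is_cvg_limn_esupE; last by apply/cvg_ex; eexists; exact: cvf.
rewrite (cvg_lim _ cvf)// unlock -[D k]setIT -integral_indic//.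
apply: ge0_le_integral => //.
- by move=> w _; rewrite lee_fin.
- exact: mf.
- by apply/measurable_EFinP; exact: measurable_indic.
move=> w _; rewrite lee_fin indicE.
have [_|wD] := boolP (w \in D k); first exact: f1.
have {wD} : h (G w) < - k.+1%:R^-1.
  by rewrite ltNge; apply/negP => Dw; move/negP : wD; apply; rewrite inE.
rewrite -mulN1r ltr_pdivlMr ?ltr0n// => hw.
by rewrite /f max_l ?ge_min ?lexx ?orbT// -lerBrDl sub0r mulrC ltW.
Qed.

End limsup_in_law.

Section fluctuation.
Variables (R : realType) (dO dG : measure_display).
Variables (Omega : measurableType dO) (OmegaG : measurableType dG).
Variables (P : probability Omega R) (PG : probability OmegaG R).
Variables (n : nat) (Y : nat -> Omega -> 'rV[R]_n) (G : OmegaG -> 'rV[R]_n).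
Hypothesis Y_rv : forall N, (0 < N)%N -> random_vector (Y N).
Hypothesis G_rv : random_vector G.
Hypothesis Y_law : cvg_in_law P PG (fun N w => Num.sqrt (N%:R : R) *: Y N w) G.

(** Multiplying the almost sure bound by sqrt N turns [Y N] into the rescaled vector and
    [gamma / Num.sqrt N%:R] into [gamma]; the event then lies in a closed set of the rescaled
    vector. *)
Lemma limn_esup_fluctuation_le (W : nat -> Omega -> R) (beta gamma x : R) :
  (forall N, (0 < N)%N -> measurable_fun setT (W N)) ->
  (forall N, (0 < N)%N ->
    {ae P, forall w, `|W N w| <= beta * `|Y N w| + gamma / Num.sqrt N%:R}) ->
  (limn_esup (fun N => P [set w | (x <= Num.sqrt N%:R * `|W N w|)%R]) <=
   PG [set w | (x <= beta * `|G w| + gamma)%R])%E.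
Proof.
move=> mW WY; pose h (z : 'rV[R]_n) := beta * `|z| + gamma - x.
have -> : [set w | x <= beta * `|G w| + gamma] = [set w | 0 <= h (G w)].
  by apply/seteqP; split => w; rewrite /h /= subr_ge0.
apply: (limn_esup_prob_le _ G_rv Y_law).
- move=> N N0 i; under eq_fun do rewrite mxE.
  by apply: measurable_funM => //; exact: Y_rv.
- apply: locally_lipschitz_continuous => y; exists `|beta| => // z _.
  rewrite /h; have -> : beta * `|y| + gamma - x - (beta * `|z| + gamma - x) =
    beta * (`|y| - `|z|) by ring.
  by rewrite normrM ler_wpM2l// ler_dist_dist.
- move=> N N0; rewrite -[X in measurable X]setTI.
  apply: measurable_fun_le => //; apply: measurable_funM => //.
  by apply: measurableT_comp => //; exact: mW.
move=> N N0; apply: filterS (WY N N0) => w Ww /= xw.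
have sN : 0 < Num.sqrt (N%:R : R) by rewrite sqrtr_gt0 ltr0n.
rewrite /h subr_ge0 (le_trans xw)// normrZ (gtr0_norm sN).
rewrite (le_trans (ler_wpM2l (ltW sN) Ww))// mulrDr mulrCA lerD2l.
by rewrite mulrCA mulfV ?gt_eqF// mulr1.
Qed.

End fluctuation.

(** * The two particle values around the limit optimum, and the theorem *)

Section value_gap.
Variables (R : realType) (S d : nat) (A : Type).
Variable K : A -> 'rV[R]_d -> 'M[R]_S.
Variable g : 'rV[R]_d -> 'rV[R]_S -> A -> 'rV[R]_d.
Variable r : nat -> 'rV[R]_S -> 'rV[R]_d -> R.
Variable T : nat.
Hypothesis K_kernel : forall a C, transition_kernel (K a C).
Hypothesis K_lip : loc_lip (fun a (_ : 'rV[R]_S) c => K a c).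
Hypothesis g_lip : loc_lip (fun a m c => g c m a).
Hypothesis r_lip : lip_rewards r T.
Variables (m0 : 'rV[R]_S) (c0 : 'rV[R]_d) (astar : nat -> A).
Hypothesis m0_simplex : simplex m0.
Hypothesis astar_opt :
  limit_value K g r T astar m0 c0 = limit_optimal_value K g r T m0 c0.
Local Notation Vopt N := (optimal_value g r T (@jump R S d A K N)).
Local Notation Vstar N := (action_value g r T (@jump R S d A K N) astar).
Local Notation vopt := (limit_optimal_value K g r T m0 c0).

(** [astar] is optimal at (m0, c0) only, so its limit value is first moved from (M, C) to (m0, c0)
    by the Lipschitz bound. The upper estimate instead moves v* itself. *)
Lemma value_gap (B : R) : exists beta gamma : R, [/\ 0 <= beta, 0 <= gamma &
  forall N M C, (0 < N)%N -> simplexN N M -> `|C| <= B ->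
  let e := beta * `|row_mx M C - row_mx m0 c0| + gamma / Num.sqrt N%:R in
  [/\ vopt - e <= Vstar N M C, Vstar N M C <= Vopt N M C &
      Vopt N M C <= vopt + e]].
Proof.
(* The ball must contain [c0] as well, since [C] is compared with it. *)
pose B' := Num.max B `|c0|.
have [L1 [L10 lL1 _]] := loc_lip_limit_value K_kernel K_lip g_lip r_lip B'.
have [L2 [L20 lL2 _]] :=
  loc_lip_limit_optimal_value K_kernel K_lip g_lip (astar 0) r_lip B'.
have [g1 g10 fixP] := config_value_fixed_limit K_kernel K_lip g_lip r_lip B'.
have [g2 g20 optP] := config_value_le_limit K_kernel K_lip g_lip (astar 0) r_lip B'.
(* [L1] and [g1] serve the lower bound, [L2] and [g2] the upper one. The 2 bounds the sum of the
   norms of the two blocks by the norm of the joined vector. *)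
exists ((L1 + L2) * 2), (g1 + g2).
split => [||N M C N0 /(empirical_surj N0)[x ->] CB e].
- by rewrite mulr_ge0 ?addr_ge0.
- exact: addr_ge0.
have xS := simplex_empirical R N0 x.
have CB' : `|C| <= B' by rewrite le_max CB.
have cB' : `|c0| <= B' by rewrite le_max lexx orbT.
set D := `|row_mx (empirical R x) C - row_mx m0 c0| in e *.
have dD : `|empirical R x - m0| + `|C - c0| <= 2 * D.
  have := row_mx_norm_ge (empirical R x - m0) (C - c0).
  rewrite -add_row_mx -opp_row_mx -/D => -[d1 d2].
  by rewrite mulr_natl mulr2n lerD.
have sN : 0 <= (Num.sqrt (N%:R : R))^-1 by rewrite invr_ge0 sqrtr_ge0.
have eE : e = L1 * (2 * D) + L2 * (2 * D) + (g1 / Num.sqrt N%:R + g2 / Num.sqrt N%:R).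
  by rewrite /e; ring.
have D0 : 0 <= 2 * D by rewrite mulr_ge0 ?normr_ge0.
have [LD1 LD2] : 0 <= L1 * (2 * D) /\ 0 <= L2 * (2 * D) by split; exact: mulr_ge0.
have [gN1 gN2] : 0 <= g1 / Num.sqrt N%:R /\ 0 <= g2 / Num.sqrt N%:R.
  by split; exact: mulr_ge0.
have VE : Vstar N (empirical R x) C =
    config_value g r T (@jump R S d A K N) (fun t _ _ => astar t) x C.
  by rewrite /action_value (value_empirical (K := K)).
split.
- rewrite -astar_opt VE.
  have := fixP N astar x C N0 CB'.
  have := lL1 astar _ _ _ _ xS m0_simplex CB' cB'.
  rewrite !ler_distl => /andP[l1 _] /andP[f1 _].
  have := ler_wpM2l L10 dD; lra.
- by rewrite VE; exact: (value_le_optimal K_kernel K_lip g_lip (astar 0%N)).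
- apply: (sup_range_le (fun _ _ _ => astar 0%N)) => Pi.
  rewrite (value_empirical (K := K))//.
  have := optP N Pi x C N0 CB'.
  have := lL2 tt _ _ _ _ xS m0_simplex CB' cB'.
  rewrite !ler_distl => /andP[_ l2] f2.
  have := ler_wpM2l L20 dD; lra.
Qed.

End value_gap.

(** One sample point at which the initial measures converge suffices to place [m0] in the closed
    simplex. *)
Lemma ae_exists (R : realType) d (Omega : measurableType d)
    (P : probability Omega R) (Q : Omega -> Prop) :
  {ae P, forall w, Q w} -> exists w, Q w.
Proof.
move=> [N [mN PN QN]]; apply: contrapT => /forallNP nQ.
have : P setT = 0%E.
  by apply/eqP; rewrite -measure_le0 -PN le_measure ?inE// => w _; apply: QN => /nQ.
by rewrite probability_setT => -[] /eqP; rewrite oner_eq0.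
Qed.

Theorem theorem4 (R : realType) (S d T : nat)
  (S_ge1 : (1 <= S)%N) (d_ge1 : (1 <= d)%N) (T_ge1 : (1 <= T)%N)
  (A : uniformType)
  (K : A -> 'rV[R]_d -> 'M[R]_S)
  (K_kernel : forall a C, transition_kernel (K a C))
  (g : 'rV[R]_d -> 'rV[R]_S -> A -> 'rV[R]_d)
  (r : nat -> 'rV[R]_S -> 'rV[R]_d -> R)
  (Q : forall N : nat, A -> 'rV[R]_d -> config N S -> config N S -> R)
  (dO : measure_display) (Omega : measurableType dO) (P : probability Omega R)
  (M0 : nat -> Omega -> 'rV[R]_S) (C0 : nat -> Omega -> 'rV[R]_d)
  (M0_rv : forall N, (0 < N)%N -> random_vector (M0 N))
  (C0_rv : forall N, (0 < N)%N -> random_vector (C0 N))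
  (M0_simplexN : forall N, (0 < N)%N -> forall w, simplexN N (M0 N w))
  (m0 : 'rV[R]_S) (c0 : 'rV[R]_d)
  (dG : measure_display) (OmegaG : measurableType dG) (PG : probability OmegaG R)
  (G0 : OmegaG -> 'rV[R]_(S + d)) (Gamma0 : 'M[R]_(S + d))
  (A1 : forall N a C (x y : config N S),
     Q N a C x y = \prod_(n < N) K a C (x n) (y n))
  (A2 : compact [set: A])
  (A3_K : continuous (fun z : 'rV[R]_d * A => K z.2 z.1))
  (A3_g : {within [set z : 'rV[R]_d * 'rV[R]_S * A | simplex z.1.2],
     continuous (fun z : 'rV[R]_d * 'rV[R]_S * A => g z.1.1 z.1.2 z.2)})
  (A3_r : forall t, (1 <= t <= T)%N ->
     {within [set z : 'rV[R]_S * 'rV[R]_d | simplex z.1],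
       continuous (fun z : 'rV[R]_S * 'rV[R]_d => r t z.1 z.2)})
  (A3_Ka : forall C, unif_continuous (fun a : A => K a C))
  (A3_ga : forall C M, simplex M -> unif_continuous (fun a : A => g C M a))
  (A4_as : {ae P, forall w,
     (M0 N w @[N --> \oo] --> m0) /\ (C0 N w @[N --> \oo] --> c0)})
  (A4_bound : exists B : R, forall N, (0 < N)%N -> {ae P, forall w, `|C0 N w| <= B})
  (A4_gauss : gaussian_vector PG G0 0 Gamma0)
  (A4_law : cvg_in_law P PG
     (fun N w => Num.sqrt (N%:R : R) *: (row_mx (M0 N w) (C0 N w) - row_mx m0 c0)) G0)
  (A5_K : forall i j, C1_on_param setT (fun (C : 'rV[R]_d) (a : A) => K a C i j))
  (A5_g : forall k, C1_on_param [set z : 'rV[R]_(S + d) | simplex (lsubmx z)]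
     (fun (z : 'rV[R]_(S + d)) (a : A) => g (rsubmx z) (lsubmx z) a ord0 k))
  (A5_r : forall t, (1 <= t <= T)%N ->
     C1_on [set z : 'rV[R]_(S + d) | simplex (lsubmx z)]
       (fun z : 'rV[R]_(S + d) => r t (lsubmx z) (rsubmx z)))
  (astar : nat -> A)
  (astar_opt : limit_value K g r T astar m0 c0 = limit_optimal_value K g r T m0 c0) :
  (exists beta gamma : R, forall x : R,
     (limn_esup (fun N => P [set w |
        (x <= Num.sqrt N%:R *
              `|optimal_value g r T (Q N) (M0 N w) (C0 N w)
                - limit_optimal_value K g r T m0 c0|)%R])
      <= PG [set w | (x <= beta * `|G0 w| + gamma)%R])%E)
  /\
  (exists beta' gamma' : R, [/\ 0 < beta', 0 < gamma' & forall x : R,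
     (limn_esup (fun N => P [set w |
        (x <= Num.sqrt N%:R *
              `|optimal_value g r T (Q N) (M0 N w) (C0 N w)
                - action_value g r T (Q N) astar (M0 N w) (C0 N w)|)%R])
      <= PG [set w | (x <= beta' * `|G0 w| + gamma')%R])%E]).
Proof.
have QE : Q = fun N => @jump R S d A K N.
  by apply: functional_extensionality_dep => N; apply/funext => a;
    apply/funext => C; apply/funext => x; apply/funext => y; exact: A1.
rewrite QE {Q A1 QE}.
have K_lip := loc_lip_kernel (S := S) A2 K_kernel A5_K.
have g_lip := loc_lip_context A2 A3_g A5_g.
have r_lip : lip_rewards r T.
  by move=> t tT; exact: loc_lip_reward (A3_r t tT) (A5_r t tT).
have m0S : simplex m0.
  have [w [M0w _]] := ae_exists A4_as.
  have cS : closed (@simplex R S).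
    by apply: compact_closed; [exact: norm_hausdorff|exact: compact_simplex].
  apply: (closed_cvg (@simplex R S) cS _ _ M0w).
  by exists 1%N => // N /= N0; have [] := M0_simplexN N N0 w.
have [B C0B] := A4_bound.
have [beta [gamma [beta0 gamma0 gapP]]] :=
  value_gap K_kernel K_lip g_lip r_lip m0S astar_opt B.
have M0e N : (0 < N)%N -> forall w, exists x : config N S, M0 N w = empirical R x.
  by move=> N0 w; apply: empirical_surj => //; exact: M0_simplexN.
have mV N : (0 < N)%N -> measurable_fun setT (fun w =>
    optimal_value g r T (@jump R S d A K N) (M0 N w) (C0 N w)).
  move=> N0; apply: measurable_comp_finite (M0_rv N N0) (C0_rv N N0) (M0e N N0) _.
  by move=> x; exact: (continuous_optimal_value K_kernel K_lip g_lip (astar 0)).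
have mVstar N : (0 < N)%N -> measurable_fun setT (fun w =>
    action_value g r T (@jump R S d A K N) astar (M0 N w) (C0 N w)).
  move=> N0; apply: measurable_comp_finite (M0_rv N N0) (C0_rv N N0) (M0e N N0) _.
  by move=> x; exact: (continuous_action_value K_kernel K_lip g_lip).
have Y_rv N : (0 < N)%N ->
    random_vector (fun w => row_mx (M0 N w) (C0 N w) - row_mx m0 c0).
  move=> N0; apply/random_vector_subr/random_vector_row_mx.
    exact: M0_rv.
  exact: C0_rv.
have G_rv : random_vector G0 by have [] := A4_gauss.
split.
  exists beta, gamma => x.
  apply: (limn_esup_fluctuation_le Y_rv G_rv A4_law) => N N0.
    by apply: measurable_funB => //; exact: mV.
  apply: filterS (C0B N N0) => w Cw.
  have [l1 l2 l3] := gapP N _ _ N0 (M0_simplexN N N0 w) Cw.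
  by rewrite ler_distl (le_trans l1 l2).
(* Both values lie within e of v*, so they differ by at most 2e; adding 1 makes the constants
   strictly positive. *)
exists (beta * 2 + 1), (gamma * 2 + 1); split; rewrite ?ltr_wpDl ?mulr_ge0//.
move=> x; apply: (limn_esup_fluctuation_le Y_rv G_rv A4_law) => N N0.
  by apply: measurable_funB => //; [exact: mV|exact: mVstar].
apply: filterS (C0B N N0) => w Cw.
have [] := gapP N _ _ N0 (M0_simplexN N N0 w) Cw.
set V := optimal_value _ _ _ _ _ _; set V' := action_value _ _ _ _ _ _ _.
set v := limit_optimal_value _ _ _ _ _ _; set D := `|row_mx _ _ - _|.
move=> l1 l2 l3; rewrite ger0_norm ?subr_ge0//.
have D0 : 0 <= D by exact: normr_ge0.
have sN : 0 <= (Num.sqrt (N%:R : R))^-1 by rewrite invr_ge0 sqrtr_ge0.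
move: l1 l3; set q := _^-1 in sN * => l1 l3.
have : 0 <= D + q by rewrite addr_ge0.
rewrite !mulrDl !mul1r; lra.
Qed.
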